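(* Let $\mathfrak{A}$ be a nonelementary UHF C$^*$-algebra. Then there exists a normal operator $N \in \mathfrak{A}$ with $N \in \overline{Nil(\mathfrak{A})}$ such that $\sigma(N)$ is the closed unit disk $\{z \in \mathbb{C} \mid |z| \leq 1\}$.
   Context: A UHF C$^*$-algebra is a direct limit of a sequence of full matrix algebras $\mathcal{M}_{\ell_k}(\mathbb{C})$ with unital injective connecting $^*$-homomorphisms; nonelementary means it is not itself isomorphic to a full matrix algebra, i.e. it is infinite dimensional. $Nil(\mathfrak{A})$ is the set of nilpotent elements of $\mathfrak{A}$; the closure is in the norm topology; $\sigma(N)$ is the spectrum of $N$. *)

(* Defs.v *)
From HB Require Import structures.
From mathcomp Require Import all_boot all_order all_algebra.
From mathcomp Require Import all_classical all_reals all_analysis.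
From mathcomp Require Export complex.

Set Implicit Arguments.
Unset Strict Implicit.
Unset Printing Implicit Defensive.

Import Order.TTheory GRing.Theory Num.Theory.
Import numFieldNormedType.Exports.

Local Open Scope classical_set_scope.
Local Open Scope ring_scope.
Local Open Scope complex_scope.
Local Open Scope sesquilinear_scope.

(* Unital C*-algebras, with [1 != 0]. Over the scalars [R[i]] the norm also
   takes its values in [R[i]]; being nonnegative for the order of [R[i]], they
   are real. This is not an HB structure because the hierarchy has no join of
   rings and normed modules below [numDomainType]; the ring and algebra
   structures are instead declared as instances on the carrier. *)
Record cstarType (R : realType) := CStarAlgebra {
  cstar_space : completeNormedModType R[i] ;
  cstar_one : cstar_space ;
  cstar_mul : cstar_space -> cstar_space -> cstar_space ;
  cstar_star : cstar_space -> cstar_space ;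
  cstar_mulA : associative cstar_mul ;
  cstar_mul1 : left_id cstar_one cstar_mul ;
  cstar_mulr1 : right_id cstar_one cstar_mul ;
  cstar_mulDl : left_distributive cstar_mul +%R ;
  cstar_mulDr : right_distributive cstar_mul +%R ;
  cstar_one_neq0 : cstar_one != 0 ;
  cstar_scaleAl : forall (a : R[i]) x y,
    a *: cstar_mul x y = cstar_mul (a *: x) y ;
  cstar_scaleAr : forall (a : R[i]) x y,
    a *: cstar_mul x y = cstar_mul x (a *: y) ;
  cstar_starK : involutive cstar_star ;
  cstar_starD : {morph cstar_star : x y / x + y} ;
  cstar_starZ : forall (a : R[i]) x, cstar_star (a *: x) = a^* *: cstar_star x ;
  cstar_starM : forall x y,
    cstar_star (cstar_mul x y) = cstar_mul (cstar_star y) (cstar_star x) ;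
  cstar_normM : forall x y, `|cstar_mul x y| <= `|x| * `|y| ;
  cstar_normS : forall x, `|cstar_mul (cstar_star x) x| = `|x| ^+ 2
}.

Definition cstar_sort (R : realType) (A : cstarType R) : Type := cstar_space A.
Coercion cstar_sort : cstarType >-> Sortclass.

Section CStarInstances.
Variables (R : realType) (A : cstarType R).

HB.instance Definition _ :=
  CompleteNormedModule.copy (cstar_sort A) (cstar_space A).
HB.instance Definition _ := GRing.Zmodule_isNzRing.Build (cstar_sort A)
  (@cstar_mulA R A) (@cstar_mul1 R A) (@cstar_mulr1 R A)
  (@cstar_mulDl R A) (@cstar_mulDr R A) (@cstar_one_neq0 R A).
HB.instance Definition _ :=
  GRing.Lmodule_isLalgebra.Build R[i] (cstar_sort A) (@cstar_scaleAl R A).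
HB.instance Definition _ :=
  GRing.Lalgebra_isAlgebra.Build R[i] (cstar_sort A) (@cstar_scaleAr R A).

Definition star (x : A) : A := cstar_star x.

End CStarInstances.

Section CStarAlgebraNotions.
Variable R : realType.
Local Notation C := R[i].
Implicit Types A B : cstarType R.

(* An [{lrmorphism A -> B}] is a [C]-algebra morphism preserving 1. *)
Definition star_morphism A B (f : {lrmorphism A -> B}) : Prop :=
  forall x, f (star x) = star (f x).

(* [M ^t*] is the conjugate transpose; ['M_n.+1] covers all sizes >= 1.
   Only the *-algebra structure of ['M_n.+1] is used: its library norm is the
   sup norm of the entries, not the C*-norm. *)
Definition full_matrix_algebra A : Prop :=
  exists (n : nat) (f : {lrmorphism A -> 'M[C]_n.+1}),
    bijective f /\ forall x, f (star x) = (f x) ^t*.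

Section DirectLimit.
Variables (B : nat -> cstarType R).
Variable phi : forall k, {lrmorphism B k -> B k.+1}.

Fixpoint connecting (k j : nat) : B k -> B (j + k)%N :=
  if j is j'.+1 then fun x => phi (j' + k)%N (connecting j' x)
  else fun x => x.

(* [A], with the canonical maps [psi], is the completion of the algebraic
   direct limit of the [B k] for the C*-seminorm given on the class of
   [x : B k] by the limit over [j] of the norms of the images of [x] in
   [B (j + k)]. *)
Definition is_direct_limit A (psi : forall k, {lrmorphism B k -> A}) : Prop :=
  [/\ forall k, star_morphism (psi k),
      forall k x, psi k.+1 (phi k x) = psi k x,
      forall k (x : B k), `|connecting j x| @[j --> \oo] --> `|psi k x|
    & closure (\bigcup_k range (psi k)) = setT].

End DirectLimit.

Definition UHF A : Prop :=
  exists (B : nat -> cstarType R) (phi : forall k, {lrmorphism B k -> B k.+1})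
         (psi : forall k, {lrmorphism B k -> A}),
    [/\ forall k, full_matrix_algebra (B k),
        forall k, star_morphism (phi k),
        forall k, injective (phi k)
      & is_direct_limit phi psi].

Definition nonelementary A : Prop := ~ full_matrix_algebra A.

Definition nilpotents A : set A := [set x | exists n : nat, x ^+ n = 0].

Definition normal_operator A (x : A) : Prop := star x * x = x * star x.

Definition invertible A (x : A) : Prop :=
  exists y : A, y * x = 1 /\ x * y = 1.

Definition spectrum A (x : A) : set C := [set z | ~ invertible (x - z%:A)].

End CStarAlgebraNotions.

Arguments nilpotents {R} A.

(* Main.v *)
From HB Require Import structures.
Require Import Defs.
From mathcomp Require Import all_boot all_order all_algebra.
From mathcomp Require Import all_classical all_reals all_analysis.
From mathcomp Require Import ring lra.
Import Order.TTheory GRing.Theory Num.Theory.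
Import numFieldNormedType.Exports.

Set Implicit Arguments.
Unset Strict Implicit.
Unset Printing Implicit Defensive.

Local Open Scope classical_set_scope.
Local Open Scope ring_scope.
Local Open Scope complex_scope.
Local Open Scope sesquilinear_scope.

(** The operator [N] is a norm limit of diagonal matrices [N_k] whose
    eigenvalues form finer and finer polar grids of the disk,
    [tent (a / m) * exp (2 i pi b / n)] with [a < m] and [b < n], where
    [tent] climbs from 0 to 1 on the first half of [0, 1] and descends back to
    0 on the second.

    Nested grids. A UHF algebra is the closure of an increasing union of matrix
    algebras. A system of matrix units in one of them splits in the next: each
    diagonal unit is a sum of orthogonal projections of rank one
    ([refine_units]). If from some stage on the splitting were trivial, the
    algebra would be the finite-dimensional span of the units; so in a
    nonelementary algebra the splitting can be made proper, again and again
    ([nonelementary_refine]). Spending alternate splittings on the radii and on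
    the angles gives grids with mesh at most [c / 2 ^ k], each [N_k] being
    diagonal in a system refining the previous one; hence
    [|N_k - N_(k+1)| <= c / 2 ^ k] ([level_refine]) and the limit [N] exists.
    It is normal. A point outside the disk keeps distance at least [|z| - 1]
    from all the eigenvalues, so the inverses of [N_k - z] converge; a point of
    the disk is nearly an eigenvalue of [N_k], with a unit as eigenprojection,
    so [N - z] is not bounded below.

    Nilpotents near [N_k]. This is Berg's technique. The discrete Fourier
    transform in [b] turns [N_k] into [D U], where [D] is diagonal with entries
    [tent (a / m)] and [U] shifts [b] cyclically ([fourier_unitary]): a direct
    sum of [m] cycles of length [n], cycle [a] having constant weight
    [tent (a / m)]. To link these cycles into a single one, write the cyclic
    permutation of the rows [a] as the product of the reflections [a |-> - a]
    and [a |-> 1 - a]. A symmetry [E] is joined to 1 by the unitaries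
    [twist E y], where [y] runs over the upper half circle, so the product of
    the two reflections is joined to 1; the path is followed in [n] small steps
    as [b] goes round the cycle. The values of [tent] being nearly invariant
    under both reflections, all the unitaries on the path nearly commute with
    [D], and conjugating along the path moves [D U] by at most the mesh
    ([twisted_conjugate_close]). The result is unitarily equivalent to a
    weighted permutation in which every orbit passes through row 0, where the
    weight is [tent 0 = 0]; such an operator is nilpotent
    ([weighted_cycles_near_nilpotent]). *)

(** * Elementary facts on C*-algebras *)

Section CStarBasics.
Variables (R : realType) (A : cstarType R).
Implicit Types (x y u : A) (a c : R[i]).

Lemma starK x : star (star x) = x. Proof. exact: cstar_starK. Qed.
Lemma starD x y : star (x + y) = star x + star y. Proof. exact: cstar_starD. Qed.
Lemma starM x y : star (x * y) = star y * star x. Proof. exact: cstar_starM. Qed.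
Lemma starZ a x : star (a *: x) = Num.conj a *: star x.
Proof. exact: cstar_starZ. Qed.

Lemma star0 : star (0 : A) = 0.
Proof. by apply: (addrI (star 0)); rewrite -starD !addr0. Qed.

Lemma starN x : star (- x) = - star x.
Proof. by apply: (addrI (star x)); rewrite -starD !subrr star0. Qed.

Lemma starB x y : star (x - y) = star x - star y.
Proof. by rewrite starD starN. Qed.

Lemma star1 : star (1 : A) = 1.
Proof. by rewrite -[LHS]mul1r -[X in X * _]starK -starM mul1r starK. Qed.

Lemma star_sum (I : Type) (r : seq I) (P : pred I) (F : I -> A) :
  star (\sum_(i <- r | P i) F i) = \sum_(i <- r | P i) star (F i).
Proof. exact: (big_morph _ starD star0). Qed.

Lemma norm_mul_le x y : `|x * y| <= `|x| * `|y|.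
Proof. exact: cstar_normM. Qed.

Lemma norm_star_mul x : `|star x * x| = `|x| ^+ 2.
Proof. exact: cstar_normS. Qed.

(** The C*-identity bounds [`|x| ^+ 2] by [`|star x| * `|x|]; the two inequalities
    come from [x] and from [star x]. *)
Lemma norm_star x : `|star x| = `|x|.
Proof.
have le y : `|y| <= `|star y|.
  have [->|y0] := eqVneq y 0; first by rewrite normr0.
  by rewrite -(ler_pM2r (_ : 0 < `|y|)) ?normr_gt0// -expr2 -norm_star_mul norm_mul_le.
by apply/eqP; rewrite eq_le le -{2}(starK x) le.
Qed.

Lemma projection_norm1 x : star x = x -> x * x = x -> x != 0 -> `|x| = 1.
Proof.
move=> sx xx x0; have := norm_star_mul x; rewrite sx xx expr2 -{1}[`|x|]mulr1.
by move/(mulfI (_ : `|x| != 0)) => ->//; rewrite normr_eq0.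
Qed.

Lemma norm_one : `|1 : A| = 1.
Proof. by apply: projection_norm1; rewrite ?star1 ?mulr1 ?oner_neq0. Qed.

Definition isometry u := star u * u = 1.

Lemma norm_isometry u : isometry u -> `|u| = 1.
Proof.
move=> uu; apply/eqP; rewrite -(@eqrXn2 _ 2)// -norm_star_mul uu norm_one.
by rewrite expr1n.
Qed.

Lemma norm_mul_le_r c x y : `|x| <= c -> `|y| <= 1 -> `|x * y| <= c.
Proof.
move=> xc y1; apply: (le_trans (norm_mul_le _ _)); apply: (le_trans _ xc).
by rewrite -[leRHS]mulr1 ler_wpM2l.
Qed.

Lemma norm_mul_le_l c x y : `|x| <= 1 -> `|y| <= c -> `|x * y| <= c.
Proof.
move=> x1 yc; apply: (le_trans (norm_mul_le _ _)); apply: (le_trans _ yc).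
by rewrite -[leRHS]mul1r ler_wpM2r.
Qed.

Lemma isometryM u v : isometry u -> isometry v -> isometry (u * v).
Proof.
by move=> uu vv; rewrite /isometry starM mulrA -(mulrA (star v)) uu mulr1 vv.
Qed.

End CStarBasics.

Section Unimodular.
Variable R : realType.
Local Notation C := R[i].

(** A chord: the line through [w] orthogonal to the direction of [w] meets the
    unit circle in two points with midpoint [w]. *)
Lemma half_unimodular (w : C) : `|w| <= 1 ->
  exists a b : C, [/\ Num.conj a * a = 1, Num.conj b * b = 1 & w = 2^-1 * (a + b)].
Proof.
move=> w1.
have [u [r [u1 r0 r1 ->]]] : exists u r : C,
    [/\ Num.conj u * u = 1, 0 <= r, r <= 1 & w = u * r].
  have [->|w0] := eqVneq w 0.
    by exists 1, 0; rewrite conjC1 mulr1 mulr0 lexx ler01.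
  exists (w / `|w|), `|w|; split=> //; last by rewrite mulfVK ?normr_eq0.
  rewrite mulrC -normCK normf_div normr_id divff ?expr1n// ?normr_eq0 //.
set s := sqrtC (1 - r ^+ 2).
have s0 : 0 <= s by rewrite sqrtC_ge0 subr_ge0 expr_le1.
have cr : Num.conj r = r by apply: conj_Creal; apply: ger0_real.
have cs : Num.conj s = s by apply: conj_Creal; apply: ger0_real.
have ss : s ^+ 2 = 1 - r ^+ 2 by rewrite sqrtCK.
have ii : ('i : C) ^+ 2 = -1 by rewrite sqrCi.
have aux (v : C) : Num.conj v * v = 1 -> Num.conj (u * v) * (u * v) = 1.
  by move=> vv; rewrite rmorphM mulrACA u1 vv mulr1.
exists (u * (r + 'i * s)), (u * (r - 'i * s)); split.
- apply: aux; rewrite rmorphD rmorphM /= conjCi cr cs.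
  transitivity (r ^+ 2 - 'i ^+ 2 * s ^+ 2); first by ring.
  by rewrite ii ss; ring.
- apply: aux; rewrite rmorphB rmorphM /= conjCi cr cs.
  transitivity (r ^+ 2 - 'i ^+ 2 * s ^+ 2); first by ring.
  by rewrite ii ss; ring.
- by field.
Qed.
End Unimodular.

(** * Systems of matrix units and weighted permutations *)

Section MatrixUnits.
Variables (R : realType) (A : cstarType R).
Local Notation C := R[i].

Record matrix_units (I : finType) (e : I -> I -> A) : Prop := MatrixUnits {
  unitsM : forall x y z t, e x y * e z t = if y == z then e x t else 0 ;
  units_star : forall x y, star (e x y) = e y x ;
  units_sum : \sum_x e x x = 1 }.

Variables (I : finType) (e : I -> I -> A).
Implicit Types (p q : I -> I) (v w : I -> C).

(** In matrix terms, column [x] has the single entry [w x], in row [p x]. Almost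
    all the operators below have this form, so that products reduce to
    compositions of index maps. *)
Definition monomial p w : A := \sum_x w x *: e (p x) x.
Definition diagonal w := monomial id w.

Lemma eq_monomial p q v w : p =1 q -> v =1 w -> monomial p v = monomial q w.
Proof. by move=> pq vw; apply: eq_bigr => x _; rewrite pq vw. Qed.

Lemma monomialD p v w :
  monomial p v + monomial p w = monomial p (fun x => v x + w x).
Proof. by rewrite -big_split; apply: eq_bigr => x _; rewrite scalerDl. Qed.

Lemma monomialZ c p w : c *: monomial p w = monomial p (fun x => c * w x).
Proof. by rewrite scaler_sumr; apply: eq_bigr => x _; rewrite scalerA. Qed.

Lemma monomialN p w : - monomial p w = monomial p (fun x => - w x).
Proof. by rewrite -scaleN1r monomialZ; apply: eq_monomial => // x; rewrite mulN1r. Qed.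

Lemma monomialB p v w :
  monomial p v - monomial p w = monomial p (fun x => v x - w x).
Proof. by rewrite monomialN monomialD. Qed.

Lemma monomial_delta x : diagonal (fun y => (y == x)%:R) = e x x.
Proof.
rewrite /diagonal/monomial (bigD1 x)//= eqxx scale1r big1 ?addr0// => y /negPf ->.
by rewrite scale0r.
Qed.

Hypothesis he : matrix_units e.

Lemma monomialM p q v w :
  monomial p v * monomial q w = monomial (p \o q) (fun x => v (q x) * w x).
Proof.
rewrite mulr_sumr; apply: eq_bigr => x _.
rewrite -scalerAr mulr_suml (bigD1 (q x))//= -scalerAl unitsM// eqxx big1.
  by rewrite addr0 scalerA mulrC.
by move=> y /negPf yq; rewrite -scalerAl unitsM// yq scaler0.
Qed.

Lemma diagonal1 : diagonal (fun=> 1) = 1.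
Proof. by rewrite -(units_sum he); apply: eq_bigr => x _; rewrite scale1r. Qed.

Lemma monomial_star p q w : cancel p q -> cancel q p ->
  star (monomial p w) = monomial q (fun x => Num.conj (w (q x))).
Proof.
move=> pq qp; rewrite star_sum /monomial (reindex q) /=; last first.
  by exists p => x _; rewrite ?pq ?qp.
by apply: eq_bigr => x _; rewrite starZ units_star// qp.
Qed.

Lemma diagonal_star w : star (diagonal w) = diagonal (fun x => Num.conj (w x)).
Proof. exact: monomial_star. Qed.

Lemma monomial_isometry p q w : cancel p q -> cancel q p ->
  (forall x, Num.conj (w x) * w x = 1) -> isometry (monomial p w).
Proof.
move=> pq qp w1; rewrite /isometry (monomial_star _ pq qp) monomialM -diagonal1.
by apply: eq_monomial => x /=; rewrite pq.
Qed.

(** Weights in the disk are averages of unimodular weights, and a weighted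
    permutation with unimodular weights is an isometry; the bound follows
    without computing any spectral radius. *)
Lemma norm_monomial1 p q w : cancel p q -> cancel q p ->
  (forall x, `|w x| <= 1) -> `|monomial p w| <= 1.
Proof.
move=> pq qp w1.
have /choice [f hf] x : exists c : C * C, [/\ Num.conj c.1 * c.1 = 1,
    Num.conj c.2 * c.2 = 1 & w x = 2^-1 * (c.1 + c.2)].
  by have [a [b abw]] := half_unimodular (w1 x); exists (a, b).
have -> : monomial p w = 2^-1 *: (monomial p (fst \o f) + monomial p (snd \o f)).
  by rewrite monomialD monomialZ; apply: eq_monomial => // x; case: (hf x).
rewrite normrZ normfV (_ : `|2 : C| = 2) ?normr_nat// ler_pdivrMl// mulr1.
apply: (le_trans (ler_normD _ _)).
by rewrite !(norm_isometry (monomial_isometry pq qp _))// => x /=; case: (hf x).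
Qed.

Lemma norm_monomial p q w c : cancel p q -> cancel q p -> 0 <= c ->
  (forall x, `|w x| <= c) -> `|monomial p w| <= c.
Proof.
move=> pq qp; rewrite le_eqVlt => /predU1P[<-|c0] wc.
  rewrite [X in `|X|]big1 ?normr0// => x _.
  by have := wc x; rewrite normr_le0 => /eqP ->; rewrite scale0r.
have -> : monomial p w = c *: monomial p (fun x => c^-1 * w x).
  by rewrite monomialZ; apply: eq_monomial => // x; rewrite mulVKf// gt_eqF.
rewrite normrZ gtr0_norm// -[leRHS]mulr1 ler_wpM2l ?(ltW c0)//.
apply: (norm_monomial1 pq qp) => x.
by rewrite normrM normfV (gtr0_norm c0) mulrC ler_pdivrMr// mul1r.
Qed.

Lemma norm_diagonal w c : 0 <= c -> (forall x, `|w x| <= c) ->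
  `|diagonal w| <= c.
Proof. exact: norm_monomial. Qed.

(** Each unit generates all the others, hence 1. *)
Lemma unit_neq0 x : e x x != 0.
Proof.
apply/eqP => ex0; have /eqP := oner_neq0 A; apply.
rewrite -(units_sum he) big1// => y _.
have := unitsM he y x x y; rewrite eqxx => <-.
by have := unitsM he y x x x; rewrite eqxx => <-; rewrite ex0 mulr0 mul0r.
Qed.

Lemma norm_unit x : `|e x x| = 1.
Proof.
by apply: projection_norm1; rewrite ?units_star ?unitsM ?eqxx ?unit_neq0.
Qed.

Lemma norm_unit_le1 x y : `|e x y| <= 1.
Proof.
rewrite -(@expr_le1 _ 2)//; rewrite -norm_star_mul units_star// unitsM// eqxx.
by rewrite norm_unit.
Qed.

Lemma units_inhabited : inhabited I.
Proof.
have [I0|] := eqVneq #|I| 0%N; last by rewrite -lt0n => /card_gt0P[x].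
have /eqP := oner_neq0 A; case; rewrite -(units_sum he).
by rewrite big_pred0// => x; have := card0_eq I0 x; rewrite !inE.
Qed.

(** A power of a weighted permutation is one whose weights are products of [w]
    along orbit segments; a segment that is long enough contains a zero. *)
Lemma monomial_nilpotent p w :
  (forall x, exists n, w (iter n p x) = 0) -> exists n, monomial p w ^+ n = 0.
Proof.
move=> wp.
pose wn n x := \prod_(i < n) w (iter i p x).
have powE n : monomial p w ^+ n = monomial (iter n p) (wn n).
  elim: n => [|n IH].
    by rewrite expr0 -diagonal1; apply: eq_monomial => x //=; rewrite /wn big_ord0.
  rewrite exprS IH monomialM; apply: eq_monomial => x //=.
  by rewrite /wn big_ord_recr /= mulrC.
have /choice [n nP] := wp.
exists (\max_x (n x)).+1; rewrite powE /monomial big1// => x _.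
rewrite /wn (bigD1 (Ordinal (_ : n x < _)%N)) ?ltnS ?leq_bigmax//=.
by move=> ?; rewrite nP mul0r scale0r.
Qed.

End MatrixUnits.

(** * Unitary paths from the identity to a symmetry *)

Section Twist.
Variables (R : realType) (A : cstarType R).
Implicit Types (D E F O U y z x : A).

Definition unitary (u : A) := isometry u /\ isometry (star u).

Lemma unitaryM u v : unitary u -> unitary v -> unitary (u * v).
Proof.
by move=> [u1 u2] [v1 v2]; split; rewrite ?starM; apply: isometryM.
Qed.

Lemma norm_unitary u : unitary u -> `|u| = 1.
Proof. by move=> [u1 _]; apply: norm_isometry. Qed.

(** For a symmetry [E] commuting with [y], this is 1 on the eigenspace of [E]
    for 1 and [y] on the eigenspace for -1. It equals 1 at [y = 1] and [E] at
    [y = -1], and is unitary whenever [y] is. Letting [y] be an operator makes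
    it possible to follow the whole path inside a single formula. *)
Definition twist E y := 2^-1 *: (1 + E) + y * (2^-1 *: (1 - E)).

Lemma comm_twist x E y : GRing.comm x E -> GRing.comm x y ->
  GRing.comm x (twist E y).
Proof.
move=> xE xy; rewrite /twist; apply: commrD.
  by rewrite /GRing.comm -scalerAr -scalerAl mulrDr mulrDl xE mulr1 mul1r.
apply: commrM => //.
by rewrite /GRing.comm -scalerAr -scalerAl mulrBr mulrBl xE mulr1 mul1r.
Qed.

Lemma half_add_self x : (2^-1 : R[i]) *: (x + x) = x.
Proof. by rewrite -mulr2n -[x *+ 2]scaler_nat scalerA mulVf ?scale1r// pnatr_eq0. Qed.

Lemma twist_fix E y x : x * y = x -> x * twist E y = x.
Proof.
move=> xy; rewrite /twist mulrDr mulrA xy -!scalerAr -scalerDr mulrDr mulrBr mulr1.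
by rewrite addrACA subrr addr0 half_add_self.
Qed.

Lemma twist_flip E y x : x * y = - x -> x * twist E y = x * E.
Proof.
move=> xy; rewrite /twist mulrDr mulrA xy -!scalerAr -scalerDr mulrDr mulrBr.
by rewrite !mulNr !mulr1 opprK addrACA subrr add0r half_add_self.
Qed.

Lemma twist_eql E y z x : x * y = x * z -> x * twist E y = x * twist E z.
Proof. by move=> xyz; rewrite /twist !mulrDr !mulrA xyz. Qed.

Lemma twist_intertwine E U y z : GRing.comm U E -> U * y = z * U ->
  U * twist E y = twist E z * U.
Proof.
move=> UE Uy.
have Up : U * (1 + E) = (1 + E) * U by rewrite mulrDr mulrDl UE mulr1 mul1r.
have Ur : U * (1 - E) = (1 - E) * U by rewrite mulrBr mulrBl UE mulr1 mul1r.
by rewrite /twist mulrDr mulrDl mulrA Uy -!mulrA -!scalerAl -!scalerAr Up Ur.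
Qed.

Section Involution.
Variables (E : A).
Hypotheses (EE : E * E = 1) (sE : star E = E).

Let p : A := 2^-1 *: (1 + E).
Let r : A := 2^-1 *: (1 - E).

Let pp : p * p = p.
Proof.
rewrite /p -scalerAl -scalerAr mulrDr mulr1 mulrDl mul1r EE (addrC E) half_add_self.
by [].
Qed.

Let pr : p * r = 0.
Proof.
rewrite /p /r -scalerAl -scalerAr mulrBr mulr1 mulrDl mul1r EE (addrC E) subrr.
by rewrite !scaler0.
Qed.

Let prD : p + r = 1.
Proof. by rewrite -scalerDr addrACA subrr addr0 half_add_self. Qed.

Let rE : r = 1 - p. Proof. by rewrite -prD addrC addKr. Qed.
Let rp : r * p = 0. Proof. by rewrite rE mulrBl mul1r pp subrr. Qed.
Let rr : r * r = r. Proof. by rewrite {1}rE mulrBl mul1r pr subr0. Qed.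

Let half_real : Num.conj (2^-1 : R[i]) = 2^-1.
Proof. by rewrite fmorphV rmorph_nat. Qed.

Let sp : star p = p. Proof. by rewrite starZ starD star1 sE half_real. Qed.
Let sr : star r = r. Proof. by rewrite starZ starB star1 sE half_real. Qed.

Lemma twist_unitary y : GRing.comm y E -> unitary y -> unitary (twist E y).
Proof.
move=> yE [y1 y2]; have yp : y * p = p * y.
  by rewrite -scalerAr -scalerAl mulrDr mulrDl yE mulr1 mul1r.
have yr : y * r = r * y by rewrite rE mulrBr mulrBl mulr1 mul1r yp.
have pyr : p * (y * r) = 0 by rewrite mulrA -yp -mulrA pr mulr0.
have s : star (twist E y) = p + r * star y by rewrite starD starM sp sr.
rewrite /isometry in y1 y2; rewrite starK in y2.
split; rewrite /isometry ?starK s -/p -/r.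
  have ryp : r * star y * p = 0.
    by have := congr1 (@star _ A) pyr; rewrite !starM sp sr star0.
  rewrite mulrDr !mulrDl pp pyr ryp -mulrA [star y * (y * r)]mulrA y1 mul1r rr.
  by rewrite addr0 add0r prD.
rewrite mulrDr !mulrDl pp (mulrA p r) pr mul0r -(mulrA y) rp mulr0.
rewrite -(mulrA y) (mulrA r r) rr.
by rewrite addr0 add0r mulrA yr -mulrA y2 mulr1.
Qed.

Lemma norm_twistB y z : `|twist E y - twist E z| <= `|y - z|.
Proof.
rewrite /twist opprD addrACA subrr add0r -mulrBl.
apply: norm_mul_le_r => //; rewrite normrZ normfV (_ : `|2 : R[i]| = 2) ?normr_nat//.
rewrite ler_pdivrMl// mulr1; apply: (le_trans (ler_normB _ _)).
by rewrite norm_one (@norm_isometry _ _ E) // /isometry sE.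
Qed.

(** The commutator of [D] with [twist E y] is that of [D] with [E], multiplied
    by [(1 - y) / 2]. *)
Lemma norm_twist_comm D y : GRing.comm D y -> `|y| <= 1 ->
  `|D * twist E y - twist E y * D| <= `|D * E - E * D|.
Proof.
move=> Dy y1; have -> : D * twist E y - twist E y * D =
    2^-1 *: (D * E - E * D) - y * (2^-1 *: (D * E - E * D)).
  have Dp : D * (2^-1 *: (1 + E)) - 2^-1 *: (1 + E) * D = 2^-1 *: (D * E - E * D).
    rewrite -scalerAr -scalerAl -scalerBr mulrDr mulrDl mulr1 mul1r.
    by rewrite opprD addrACA subrr add0r.
  have Dr : D * (2^-1 *: (1 - E)) - 2^-1 *: (1 - E) * D = - (2^-1 *: (D * E - E * D)).
    rewrite -scalerAr -scalerAl -scalerBr mulrBr mulrBl mulr1 mul1r -scalerN.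
    by rewrite !opprB [X in _ *: X]addrC addrA subrK.
  rewrite /twist mulrDr mulrDl mulrA Dy -!mulrA opprD addrACA Dp -mulrBr Dr.
  by rewrite mulrN.
apply: (le_trans (ler_normB _ _)).
have h : `|2^-1 *: (D * E - E * D)| = 2^-1 * `|D * E - E * D|.
  by rewrite normrZ normfV normr_nat.
rewrite -[leRHS](mulKf (_ : 2 != 0))// mulr_natl mulrnAr mulr2n.
by rewrite lerD ?h// norm_mul_le_l ?h.
Qed.

End Involution.
End Twist.

Section BergAbstract.
Variables (R : realType) (A : cstarType R).

(** On the complement of the projection [e0] the operators [y] and [z] agree, so
    the twists do too; on [e0], where [y = 1] and [z = -1], the product of
    twists starts at 1 and ends at [E * O]. *)
Lemma twist_product_flip (E O y z e0 : A) :
  GRing.comm e0 E -> GRing.comm e0 O -> GRing.comm e0 y ->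
  e0 * y = e0 -> e0 * z = - e0 -> (1 - e0) * z = (1 - e0) * y ->
  twist E z * twist O z = ((1 - e0) + E * O * e0) * (twist E y * twist O y).
Proof.
move=> e0E e0O ce0 e0y e0z e1.
set W := twist E y * _; set W1 := twist E z * _.
have e0W : e0 * W = e0 by rewrite mulrA !twist_fix.
have e0W1 : e0 * W1 = E * O * e0.
  by rewrite mulrA (twist_flip _ e0z) e0E -mulrA twist_flip// e0O mulrA.
have c1 : GRing.comm (1 - e0) (twist E y).
  apply: comm_twist; rewrite /GRing.comm mulrBl mulrBr mul1r mulr1.
    by rewrite e0E.
  by rewrite ce0.
have e1W : (1 - e0) * W1 = (1 - e0) * W.
  by rewrite !mulrA (twist_eql _ e1) c1 -!mulrA (twist_eql _ e1).
by rewrite mulrDl -(mulrA _ e0) e0W -e0W1 -e1W -mulrDl subrK mul1r.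
Qed.

(** Let [y0 = zeta^-1 *: z], so that [U * y = y0 * U]. Moving the twists from
    the right of [U] to its left turns [y] into [y0], and the operator becomes
    [star W1 * D * W0 * U] with [W0], [W1] the products of twists at [y0] and at
    [z]. It differs from [D * U] by the commutator of [D] with [W0], where only
    [O] contributes as [D] commutes with [E], and by [W0 - W1], where each of the two twists contributes
    at most [`|y0 - z| = `|1 - zeta|]. *)
Lemma twisted_conjugate_close (D E O U y z : A) (zeta c : R[i]) :
  E * E = 1 -> star E = E -> O * O = 1 -> star O = O ->
  unitary z -> GRing.comm z E -> GRing.comm z O ->
  GRing.comm D E -> GRing.comm U E -> GRing.comm U O -> GRing.comm D z ->
  unitary U -> Num.conj zeta * zeta = 1 -> z * U = zeta *: (U * y) ->
  `|D| <= 1 -> `|D * O - O * D| <= c ->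
  `|star (twist E z * twist O z) * D * U * (twist E y * twist O y) - D * U|
     <= c + 2 * `|1 - zeta|.
Proof.
move=> EE sE OO sO uz zE zO DE UE UO Dz uU zeta1 zU D1 Dc.
have zeta0 : zeta != 0.
  by apply: contra_eq_neq zeta1 => ->; rewrite mulr0 eq_sym oner_eq0.
pose y0 : A := zeta^-1 *: z.
have zy0 : z = zeta *: y0 by rewrite scalerA divff ?scale1r.
have Uy : U * y = y0 * U by rewrite -scalerAl zU scalerA mulVf ?scale1r.
have cy0 F : GRing.comm F z -> GRing.comm F y0.
  by move=> h; rewrite /GRing.comm -scalerAr -scalerAl h.
have uy0 : unitary y0.
  have h : Num.conj zeta^-1 * zeta^-1 = 1 by rewrite fmorphV -invfM zeta1 invr1.
  case: uz => z1 z2; split; rewrite /isometry ?starK starZ.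
    by rewrite -scalerAl -scalerAr scalerA h z1 scale1r.
  by rewrite -scalerAl -scalerAr scalerA mulrC h scale1r; move: z2; rewrite /isometry starK.
have cs F G : GRing.comm F G -> GRing.comm G F by exact: commr_sym.
have y0E : GRing.comm y0 E by apply/cs/cy0/cs.
have y0O : GRing.comm y0 O by apply/cs/cy0/cs.
set W := twist E y * _; set W1 := twist E z * _.
pose W0 := twist E y0 * twist O y0.
have UW : U * W = W0 * U.
  by rewrite mulrA (twist_intertwine UE Uy) -mulrA (twist_intertwine UO Uy) mulrA.
have uW1 : unitary W1 by apply: unitaryM; apply: twist_unitary.
have uW0 : unitary W0 by apply: unitaryM; apply: twist_unitary.
have uEy0 : unitary (twist E y0) by apply: twist_unitary.
have uOy0 : unitary (twist O y0) by apply: twist_unitary.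
have uEz : unitary (twist E z) by apply: twist_unitary.
have -> : star W1 * D * U * W - D * U =
    star W1 * ((D * W0 - W0 * D + (W0 - W1) * D) * U).
  rewrite -(mulrA _ U) UW; case: uW1; rewrite /isometry => + _.
  move: (W1) (W0) => u w uu; rewrite mulrBl addrA subrK mulrBl mulrBr !mulrA.
  by rewrite uu mul1r.
apply: norm_mul_le_l; first by rewrite norm_star norm_unitary.
apply: norm_mul_le_r; last by rewrite norm_unitary.
apply: (le_trans (ler_normD _ _)); apply: lerD.
  have -> : D * W0 - W0 * D = twist E y0 * (D * twist O y0 - twist O y0 * D).
    rewrite mulrBr !mulrA; congr (_ - _).
    by rewrite (comm_twist DE (cy0 _ Dz)).
  apply: norm_mul_le_l; first by rewrite norm_unitary.
  apply: le_trans Dc; apply: norm_twist_comm => //; first exact: cy0.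
  by rewrite norm_unitary.
apply: norm_mul_le_r => //.
have yz : `|y0 - z| <= `|1 - zeta|.
  by rewrite zy0 -{1}[y0]scale1r -scalerBl normrZ (norm_unitary uy0) mulr1.
(* Change one factor of the product at a time. *)
have -> : W0 - W1 = (twist E y0 - twist E z) * twist O y0
    + twist E z * (twist O y0 - twist O z).
  by rewrite mulrBl mulrBr addrA subrK.
rewrite mulr_natl mulr2n; apply: (le_trans (ler_normD _ _)); apply: lerD.
  apply: norm_mul_le_r; last by rewrite norm_unitary.
  exact: le_trans (norm_twistB _ _ _ _) yz.
apply: norm_mul_le_l; first by rewrite norm_unitary.
exact: le_trans (norm_twistB _ _ _ _) yz.
Qed.
End BergAbstract.

(** * Berg's technique for weighted cycles *)

Section Cyclic.
Variable n : nat.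

Lemma val_succ_ord (i : 'I_n.+1) : nat_of_ord (i + Zp1) = (i.+1 %% n.+1)%N.
Proof. by rewrite /= modnDmr addn1. Qed.

Lemma succ_ord_lt (i : 'I_n.+1) : (i < n)%N -> nat_of_ord (i + Zp1) = i.+1.
Proof. by move=> i_n; rewrite val_succ_ord modn_small. Qed.

Lemma succ_ord_max (i : 'I_n.+1) : nat_of_ord i = n -> i + Zp1 = 0.
Proof. by move=> i_n; apply: ord_inj; rewrite val_succ_ord i_n modnn. Qed.

Lemma succ_ord_neq0 (i : 'I_n.+1) : (i < n)%N -> (i + Zp1 == 0) = false.
Proof. by move=> i_n; rewrite -(inj_eq (@ord_inj _)) succ_ord_lt. Qed.

End Cyclic.

Section Spiral.
Variables L M : nat.
Local Notation I := ('I_L.+1 * 'I_M.+1)%type.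

(** The single orbit structure into which the rows, seen as cycles, get linked. *)
Definition spiral (x : I) : I :=
  if x.2 + Zp1 == 0 then (x.1 + Zp1, 0) else (x.1, x.2 + Zp1).

Lemma spiral_next_row (x : I) :
  exists n, iter n spiral x = (x.1 + Zp1, 0).
Proof.
have [k] := ubnP (M - x.2); elim: k x => // k IH x.
rewrite ltnS => xk.
have [xM|xM] := leqP M x.2.
  exists 1%N; rewrite /= /spiral succ_ord_max ?eqxx//.
  by apply/eqP; rewrite eqn_leq xM -ltnS ltn_ord.
have [|n] := IH (spiral x).
  rewrite /spiral succ_ord_neq0// (succ_ord_lt xM).
  by rewrite (leq_trans _ xk)// ltn_sub2l.
rewrite -iterSr {2}/spiral succ_ord_neq0//= => nE.
by exists n.+1.
Qed.

(** Rows follow one another cyclically, so each orbit visits all of them. *)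
Lemma spiral_reaches_row0 (x : I) : exists n, (iter n spiral x).1 = 0.
Proof.
have [k] := ubnP (L - x.1); elim: k x => // k IH x.
rewrite ltnS => xk; have [n nE] := spiral_next_row x.
have [xM|xM] := leqP L x.1.
  exists n; rewrite nE/= succ_ord_max//.
  by apply/eqP; rewrite eqn_leq xM -ltnS ltn_ord.
have [|m mE] := IH (iter n spiral x).
  by rewrite nE succ_ord_lt// (leq_trans _ xk)// ltn_sub2l.
by exists (m + n)%N; rewrite iterD.
Qed.

End Spiral.

Section Berg.
Variables (R : realType) (A : cstarType R) (L M : nat).
Local Notation I := ('I_L.+1 * 'I_M.+1)%type.
Local Notation C := R[i].
Variables (e : I -> I -> A) (he : matrix_units e).

(** With [y] having the entry [zeta ^+ j] in column [j], the product of twists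
    follows, column by column, a path that joins 1 to the composite of the two
    reflections, because [zeta ^+ M.+1 = -1]. The path does not close up: its
    end point must be used in place of its starting point when column 0 is
    reached again, which is the difference between [y] and [z]. The defect is
    the cyclic permutation of the rows that turns the separate cycles into the
    single orbit structure of [spiral]. *)
Lemma weighted_cycles_near_nilpotent (t : 'I_L.+1 -> C) (zeta c : C) :
  (forall a, `|t a| <= 1) -> (forall a, t (- a) = t a) -> t 0 = 0 -> 0 <= c ->
  (forall a, `|t (Zp1 - a) - t a| <= c) ->
  zeta ^+ M.+1 = -1 -> Num.conj zeta * zeta = 1 ->
  exists2 Q, nilpotents A Q &
    `|Q - monomial e (fun x => (x.1, x.2 + Zp1)) (fun x => t x.1)|
      <= c + 2 * `|1 - zeta|.
Proof.
move=> t1 tN t0 c0 tc zM zeta1.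
have zk k : Num.conj (zeta ^+ k) * zeta ^+ k = 1.
  by rewrite rmorphXn -exprMn zeta1 expr1n.
pose f (x : I) : I := (- x.1, x.2).
pose g (x : I) : I := (Zp1 - x.1, x.2).
pose s (x : I) : I := (x.1, x.2 + Zp1).
pose s' (x : I) : I := (x.1, x.2 - Zp1).
have fK : cancel f f by case=> a b; rewrite /f /= opprK.
have gK : cancel g g by case=> a b; rewrite /g /= opprB addrC subrK.
have sK : cancel s s' by case=> a b; rewrite /s /s' /= addrK.
have s'K : cancel s' s by case=> a b; rewrite /s /s' /= subrK.
pose E := monomial e f (fun=> 1).
pose O := monomial e g (fun=> 1).
pose U := monomial e s (fun=> 1).
pose D := diagonal e (fun x => t x.1).
pose yw (x : I) := zeta ^+ x.2.
pose zw (x : I) := if x.2 == 0 then -1 else zeta ^+ x.2.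
pose y := diagonal e yw.
pose z := diagonal e zw.
pose e0 := diagonal e (fun x => (x.2 == 0)%:R).
have c11 : Num.conj (1 : C) * 1 = 1 by rewrite conjC1 mulr1.
have EE : E * E = 1.
  by rewrite monomialM// -(diagonal1 he); apply: eq_monomial => x /=; rewrite ?mulr1.
have OO : O * O = 1.
  by rewrite monomialM// -(diagonal1 he); apply: eq_monomial => x /=; rewrite ?mulr1.
have sE : star E = E.
  by rewrite (monomial_star he _ fK fK); apply: eq_monomial => // x; rewrite conjC1.
have sO : star O = O.
  by rewrite (monomial_star he _ gK gK); apply: eq_monomial => // x; rewrite conjC1.
have uU : unitary U.
  split; first exact: (monomial_isometry he sK s'K).
  rewrite (monomial_star he _ sK s'K); apply: (monomial_isometry he s'K sK) => x.
  by rewrite conjC1.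
have udiag (w : I -> C) : (forall x, Num.conj (w x) * w x = 1) ->
    unitary (diagonal e w).
  move=> w1; split; first exact: (monomial_isometry he (fun=> erefl) (fun=> erefl)).
  rewrite diagonal_star//.
  apply: (monomial_isometry he (fun=> erefl) (fun=> erefl)) => x.
  by rewrite conjCK mulrC.
have uy : unitary y by apply: udiag => x; rewrite zk.
have uz : unitary z.
  apply: udiag => x; rewrite /zw; case: ifP => // _.
  by rewrite rmorphN1 mulrNN mulr1.
have comm_diag (w : I -> C) p v : (forall x, w (p x) = w x) ->
    GRing.comm (diagonal e w) (monomial e p v).
  move=> wp; rewrite /GRing.comm !monomialM//; apply: eq_monomial => // x /=.
  by rewrite wp mulrC.
have comm_dd (w v : I -> C) : GRing.comm (diagonal e w) (diagonal e v).
  exact: comm_diag.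
have yE : GRing.comm y E by apply: comm_diag.
have yO : GRing.comm y O by apply: comm_diag.
have zE : GRing.comm z E by apply: comm_diag.
have zO : GRing.comm z O by apply: comm_diag.
have e0E : GRing.comm e0 E by apply: comm_diag.
have e0O : GRing.comm e0 O by apply: comm_diag.
have ddE w v : diagonal e w * diagonal e v = diagonal e (fun x => w x * v x).
  by rewrite monomialM.
have e0y : e0 * y = e0.
  rewrite ddE; apply: eq_monomial => // x /=; case: eqP => [x0|_]; rewrite ?mul0r//.
  by rewrite /yw x0 expr0 mulr1.
have e0z : e0 * z = - e0.
  rewrite ddE monomialN; apply: eq_monomial => // x /=; rewrite /zw.
  by case: eqP => [x0|_]; rewrite ?mul0r ?oppr0// mul1r.
have e0C : 1 - e0 = diagonal e (fun x => (x.2 != 0)%:R).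
  rewrite -(diagonal1 he) monomialB; apply: eq_monomial => // x.
  by case: (x.2 == 0); rewrite ?subrr ?subr0.
have e1 : (1 - e0) * z = (1 - e0) * y.
  rewrite e0C !ddE; apply: eq_monomial => // x /=; rewrite /zw /yw.
  by case: eqP; rewrite ?mul0r ?mul1r.
have WE := twist_product_flip e0E e0O (comm_dd _ _) e0y e0z e1.
have uW : unitary (twist E y * twist O y).
  by apply: unitaryM; apply: twist_unitary.
have DE : GRing.comm D E by apply: comm_diag => x /=; rewrite tN.
have UE : GRing.comm U E by rewrite /GRing.comm !monomialM.
have UO : GRing.comm U O by rewrite /GRing.comm !monomialM.
have Dz : GRing.comm D z by apply: comm_dd.
have zws x : zw (s x) = zeta ^+ x.2.+1.
  rewrite /zw; have [xM|xM] := ltnP x.2 M.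
    by rewrite succ_ord_neq0// (succ_ord_lt xM).
  have {}xM : nat_of_ord x.2 = M by apply/eqP; rewrite eqn_leq xM -ltnS ltn_ord.
  by rewrite (_ : (s x).2 = 0) ?eqxx ?xM ?zM// [LHS]succ_ord_max.
have zU : z * U = zeta *: (U * y).
  rewrite !monomialM// monomialZ; apply: eq_monomial => // x.
  rewrite mulr1 mul1r -exprS zws//.
have D1 : `|D| <= 1 by apply: norm_diagonal.
have Dc : `|D * O - O * D| <= c.
  rewrite !monomialM// (@eq_monomial _ _ _ e (g \o id) (id \o g)
    (fun x => 1 * _) (fun x => t x.1))//.
    rewrite monomialB; apply: (norm_monomial he gK gK) => // x /=.
    by rewrite mulr1.
  by move=> x; rewrite mul1r.
exists (star (twist E z * twist O z) * D * U * (twist E y * twist O y));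
  last first.
  have -> : monomial e (fun x => (x.1, x.2 + Zp1)) (fun x => t x.1) = D * U.
    by rewrite monomialM//; apply: eq_monomial => // x; rewrite mulr1.
  exact: twisted_conjugate_close.
move: (twist E y * twist O y) WE uW => W WE uW; set Q := star _ * D * U * W.
pose h (x : I) : I := if x.2 == 0 then (x.1 - Zp1, 0) else x.
pose h' (x : I) : I := if x.2 == 0 then (x.1 + Zp1, 0) else x.
have hK : cancel h h'.
  case=> a b; rewrite /h /h' /=; have [->|b0] /= := eqVneq b 0.
    by rewrite ?eqxx subrK.
  by rewrite (negPf b0).
have h'K : cancel h' h.
  case=> a b; rewrite /h /h' /=; have [->|b0] /= := eqVneq b 0.
    by rewrite ?eqxx addrK.
  by rewrite (negPf b0).
have PE : (1 - e0) + E * O * e0 = monomial e h (fun=> 1).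
  rewrite e0C !monomialM// -big_split; apply: eq_bigr => -[a b] _ /=.
  rewrite /h /f /g /=; case: eqP => [->|_].
    by rewrite scale0r add0r !mul1r opprB.
  by rewrite mulr0 scale0r addr0.
(* Conjugating by [W] leaves only the defect [P] of the path, which is monomial. *)
have WQ : W * Q = monomial e (@spiral L M) (fun x => t x.1) * W.
  rewrite /Q WE PE starM (monomial_star he _ hK h'K) !mulrA.
  case: uW => _; rewrite /isometry starK => ->; rewrite mul1r !monomialM//.
  congr (_ * W); apply: eq_monomial => x /=; rewrite ?mulr1 ?conjC1 ?mul1r//.
have WQn n : W * Q ^+ n = monomial e (@spiral L M) (fun x => t x.1) ^+ n * W.
  elim: n => [|n IH]; first by rewrite !expr0 mulr1 mul1r.
  by rewrite exprS mulrA WQ -mulrA IH mulrA -exprS.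
have [|n n0] := @monomial_nilpotent _ _ _ _ he (@spiral L M) (fun x => t x.1).
  by move=> x; have [n nE] := spiral_reaches_row0 x; exists n; rewrite nE.
exists n; case: uW => uW _.
by rewrite -[LHS]mul1r -uW -mulrA WQn n0 mul0r mulr0.
Qed.
End Berg.

(** * The discrete Fourier transform *)

Section Kernel.
Variables (R : realType) (A : cstarType R) (I : finType).
Local Notation C := R[i].
Variables (e : I -> I -> A).
Implicit Types (m : I -> I -> C) (w : I -> C).

Definition kernel_op m : A := \sum_x \sum_y m x y *: e x y.

Lemma eq_kernel_op m1 m2 : m1 =2 m2 -> kernel_op m1 = kernel_op m2.
Proof. by move=> m12; do 2!apply: eq_bigr => ? _; rewrite m12. Qed.

Hypothesis he : matrix_units e.

Lemma kernel_op_monomial m p w :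
  kernel_op m * monomial e p w = kernel_op (fun x y => m x (p y) * w y).
Proof.
rewrite mulr_suml; apply: eq_bigr => x _.
rewrite mulr_sumr; apply: eq_bigr => y _.
rewrite -scalerAr mulr_suml (bigD1 (p y))//= -scalerAl unitsM// eqxx big1.
  by rewrite addr0 scalerA mulrC.
by move=> z /negPf zp; rewrite -scalerAl unitsM// zp scaler0.
Qed.

Lemma diagonal_kernel_op m w :
  diagonal e w * kernel_op m = kernel_op (fun x y => w x * m x y).
Proof.
rewrite /diagonal /monomial /kernel_op mulr_suml; apply: eq_bigr => x _.
rewrite mulr_sumr (bigD1 x)//= [X in _ + X]big1 ?addr0; last first.
  move=> z zx; rewrite mulr_sumr big1// => y _.
  by rewrite -scalerAl -scalerAr unitsM// eq_sym (negPf zx) !scaler0.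
rewrite mulr_sumr; apply: eq_bigr => y _.
by rewrite -scalerAl -scalerAr unitsM// eqxx scalerA.
Qed.

Lemma kernel_opM m1 m2 :
  kernel_op m1 * kernel_op m2 = kernel_op (fun x y => \sum_z m1 x z * m2 z y).
Proof.
rewrite mulr_suml; apply: eq_bigr => x _.
under [RHS]eq_bigr do rewrite scaler_suml.
rewrite exchange_big mulr_suml; apply: eq_bigr => z _.
rewrite mulr_sumr (bigD1 z)//= [X in _ + X]big1 ?addr0; last first.
  move=> u uz; rewrite mulr_sumr big1// => y _.
  by rewrite -scalerAl -scalerAr unitsM// eq_sym (negPf uz) !scaler0.
rewrite mulr_sumr; apply: eq_bigr => y _.
by rewrite -scalerAl -scalerAr unitsM// eqxx scalerA.
Qed.

Lemma kernel_op_star m : star (kernel_op m) = kernel_op (fun x y => Num.conj (m y x)).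
Proof.
rewrite star_sum /kernel_op exchange_big; apply: eq_bigr => x _.
by rewrite star_sum; apply: eq_bigr => y _; rewrite starZ units_star.
Qed.

Lemma kernel_op1 : kernel_op (fun x y => (x == y)%:R) = 1.
Proof.
rewrite -(units_sum he); apply: eq_bigr => x _.
rewrite (bigD1 x)//= eqxx scale1r big1 ?addr0// => y yx.
by rewrite eq_sym (negPf yx) scale0r.
Qed.

End Kernel.

Section Fourier.
Variables (R : realType) (A : cstarType R) (L M : nat).
Local Notation I := ('I_L.+1 * 'I_M.+1)%type.
Local Notation C := R[i].
Variables (e : I -> I -> A) (he : matrix_units e).

Lemma root_sum (r : C) n : r ^+ n = 1 -> r != 1 -> \sum_(i < n) r ^+ i = 0.
Proof.
move=> rn r1; apply: (mulfI (_ : r - 1 != 0)); first by rewrite subr_eq0.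
by rewrite -subrX1 rn subrr mulr0.
Qed.

(** The discrete Fourier transform in the second index conjugates the
    multiplication by [om ^+ j] to the cyclic shift of [j]. *)
Lemma fourier_unitary (t : 'I_L.+1 -> C) (om : C) :
  om ^+ M.+1 = 1 -> (forall d, (0 < d < M.+1)%N -> om ^+ d != 1) ->
  Num.conj om * om = 1 ->
  exists2 Phi : A, unitary Phi &
    diagonal e (fun x => t x.1 * om ^+ x.2) * Phi =
    Phi * monomial e (fun x => (x.1, x.2 + Zp1)) (fun x => t x.1).
Proof.
move=> omM om1 omc.
pose k : C := sqrtC (M.+1%:R^-1).
have kc : Num.conj k = k.
  by apply: conj_Creal; apply: ger0_real; rewrite sqrtC_ge0 invr_ge0 ler0n.
have kk : k * k = M.+1%:R^-1 by rewrite -expr2 sqrtCK.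
pose m (x y : I) : C := (x.1 == y.1)%:R * (k * om ^+ (x.2 * y.2)).
have mC x y : m x y = m y x by rewrite /m eq_sym mulnC.
have omcX n : Num.conj (om ^+ n) * om ^+ n = 1.
  by rewrite rmorphXn -exprMn omc expr1n.
have om_inj (a b : nat) : (a < b < M.+1)%N -> Num.conj (om ^+ a) * om ^+ b != 1.
  move=> /andP[ab bM]; rewrite -(subnKC (ltnW ab)) exprD mulrA omcX mul1r.
  by rewrite om1// subn_gt0 ab (leq_ltn_trans (leq_subr _ _) bM).
have orth x y : \sum_z Num.conj (m z x) * m z y = (x == y)%:R.
  rewrite -(pair_bigA _ (fun a b => Num.conj (m (a, b) x) * m (a, b) y)) /=.
  rewrite (bigD1 x.1)//= [X in _ + X]big1 ?addr0; last first.
    move=> a /negPf ax; rewrite big1// => b _.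
    by rewrite /m /= ax mul0r conjC0 mul0r.
  have -> : \sum_(b < M.+1) Num.conj (m (x.1, b) x) * m (x.1, b) y =
      (x.1 == y.1)%:R * (M.+1%:R^-1 *
        \sum_(b < M.+1) (Num.conj (om ^+ x.2) * om ^+ y.2) ^+ b).
    rewrite !mulr_sumr; apply: eq_bigr => b _.
    rewrite /m /= eqxx mul1r mulrCA; congr (_ * _).
    rewrite rmorphM /= kc mulrACA kk; congr (_ * _).
    by rewrite exprMn !rmorphXn -!exprM !(mulnC b).
  case: x y => [a b] [a' b'] /=; rewrite xpair_eqE.
  have [_|] := eqVneq a a'; last by rewrite mul0r.
  rewrite mul1r /=; have [->|bb] := eqVneq b b'.
    rewrite omcX; under eq_bigr do rewrite expr1n.
    by rewrite sumr_const card_ord mulVf// pnatr_eq0.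
  rewrite root_sum ?mulr0//.
    rewrite exprMn -rmorphXn /= -!exprM !(mulnC _ M.+1) !exprM omM.
    by rewrite !expr1n conjC1 mulr1.
  have := bb; rewrite -(inj_eq (@ord_inj _)) neq_ltn => /orP[lt|lt].
    by rewrite om_inj// lt ltn_ord.
  apply: contra_neq (om_inj b' b _); last by rewrite lt ltn_ord.
  by move=> /(congr1 Num.conj); rewrite rmorphM /= conjCK conjC1 mulrC.
exists (kernel_op e m).
  split; rewrite /isometry ?starK kernel_op_star// kernel_opM// -(kernel_op1 he).
    by apply: eq_kernel_op => x y; rewrite orth.
  apply: eq_kernel_op => x y; rewrite eq_sym -orth; apply: eq_bigr => z _.
  by rewrite (mC x) (mC y) mulrC.
rewrite diagonal_kernel_op// kernel_op_monomial//.
apply: eq_kernel_op => x y; rewrite /m /=.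
have [->|_] := eqVneq x.1 y.1; last by rewrite !mul0r mulr0.
have omX b n : om ^+ (b * (n %% M.+1)) = om ^+ (b * n).
  by rewrite exprM expr_mod -?exprM// mulnC exprM omM expr1n.
by rewrite !mul1r modnDmr addn1 omX mulnS exprD; ring.
Qed.
End Fourier.

(** * Refining matrix units in a UHF algebra *)

Section Corner.
Variable R : realType.
Local Notation C := R[i].

Lemma adjM m n p (X : 'M[C]_(m, n)) (Y : 'M[C]_(n, p)) :
  (X *m Y)^t* = Y^t* *m X^t*.
Proof. by rewrite trmx_mul map_mxM. Qed.

(** The rows of [F] are an orthonormal basis of the row space of [p]. *)
Lemma projection_factor n (p : 'M[C]_n) : p *m p = p -> p^t* = p ->
  exists q (F : 'M[C]_(q, n)), F *m F^t* = 1%:M /\ F^t* *m F = p.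
Proof.
move=> pp ps; exists (\rank p); pose F := schmidt (row_base p).
have FF : F *m F^t* = 1%:M.
  by apply/unitarymxP; apply: schmidt_unitarymx; apply: rank_leq_row.
have Fp : (F :=: p)%MS.
  exact: eqmx_trans (eqmx_schmidt_free (row_base_free _)) (eq_row_base _).
exists F; split=> //.
have /submxP[G pG] : (p <= F)%MS by rewrite Fp.
have /submxP[H FH] : (F <= p)%MS by rewrite Fp.
have FpF : F *m p = F by rewrite FH -mulmxA pp.
have : p *m (F^t* *m F) = p by rewrite {1}pG -mulmxA (mulmxA F) FF mul1mx -pG.
by move=> /(congr1 (fun X => X^t*)); rewrite !adjM trmxCK ps -mulmxA FpF.
Qed.
End Corner.

Section Embedding.
Variables (R : realType) (A : cstarType R).
Local Notation C := R[i].

(** Unital *-homomorphisms, as a predicate on bare functions: the maps of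
    interest are composed with set-theoretic inverses of isomorphisms. *)
Record embedding n (g : 'M[C]_n.+1 -> A) : Prop := Embedding {
  embD : {morph g : X Y / X + Y};
  embZ : forall c X, g (c *: X) = c *: g X;
  embM : {morph g : X Y / X *m Y >-> X * Y};
  emb_one : g 1%:M = 1;
  emb_adj : forall X, g (X^t*) = star (g X) }.

Variables (n : nat) (g : 'M[C]_n.+1 -> A) (hg : embedding g).

Lemma emb0 : g 0 = 0.
Proof. by rewrite -(scale0r 0) embZ// scale0r. Qed.

Lemma embN X : g (- X) = - g X.
Proof. by rewrite -scaleN1r embZ// scaleN1r. Qed.

Lemma emb_sum (J : Type) (r : seq J) (P : pred J) (F : J -> 'M[C]_n.+1) :
  g (\sum_(i <- r | P i) F i) = \sum_(i <- r | P i) g (F i).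
Proof. exact: (big_morph _ (embD hg) emb0). Qed.

(** Full matrix algebras are simple: if [g X = 0] and [X i j != 0], then
    sandwiching [X] between elementary matrices shows that [g] kills all the
    diagonal ones, whose sum is 1. *)
Lemma emb_inj : injective g.
Proof.
have ker X : g X = 0 -> X = 0.
  move=> gX; apply/matrixP => i j; rewrite mxE; apply/eqP/negPn/negP => Xij.
  have /eqP := oner_neq0 A; apply; rewrite -(emb_one hg) mx1_sum_delta emb_sum big1// => a _.
  have : X i j *: delta_mx a a = delta_mx a i *m X *m delta_mx j a :> 'M[C]_n.+1.
    apply/matrixP => b c; rewrite !mxE (bigD1 j)//= big1 ?addr0; last first.
      by move=> k /negPf kj; rewrite [X in _ * X]mxE kj mulr0.
    rewrite !mxE eqxx/= (bigD1 i)//= big1 ?addr0; last first.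
      by move=> k /negPf kj; rewrite mxE kj andbF mul0r.
    rewrite mxE eqxx andbT; case: (b == a); case: (c == a);
    by rewrite /= ?mulr0 ?mul0r ?mulr1 ?mul1r.
  move/(congr1 g); rewrite embZ// !embM// gX mulr0 mul0r => /eqP.
  by rewrite scaler_eq0 (negPf Xij) => /eqP.
move=> X Y XY; apply/eqP; rewrite -subr_eq0; apply/eqP/ker.
by rewrite embD// embN XY subrr.
Qed.

Lemma emb_surjective_full : (forall a, exists X, g X = a) -> full_matrix_algebra A.
Proof.
move=> /choice[h gh]; have hK : cancel g h by move=> X; apply: emb_inj; rewrite gh.
have hadd : zmod_morphism h.
  by move=> x y; apply: emb_inj; rewrite embD// embN !gh.
have hscale : scalable h by move=> c x; apply: emb_inj; rewrite embZ// !gh.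
have hmul : monoid_morphism h.
  by split => [|x y]; apply: emb_inj; rewrite ?gh ?(emb_one hg)// (embM hg) !gh.
pose a := GRing.isZmodMorphism.Build A 'M[C]_n.+1 h hadd.
pose b := GRing.isMonoidMorphism.Build A 'M[C]_n.+1 h hmul.
pose c := GRing.isScalable.Build C A 'M[C]_n.+1 *:%R h hscale.
pose f : {lrmorphism A -> 'M[C]_n.+1} := HB.pack h a b c.
exists n, f; split; first by exists g.
by move=> x; apply: emb_inj; rewrite emb_adj// /= !gh.
Qed.

(** Choose an orthonormal basis of the range of one diagonal unit and carry it
    to the ranges of the others by the units [e x x0]: together they form an
    orthonormal basis of the whole space, and [e'] are its elementary matrices.
    When the ranges are lines, the old units are already all the elementary
    matrices of that basis, so they span. *)
Lemma refine_units (I : finType) (e : I -> I -> A) (x0 : I) :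
  matrix_units e -> (forall x y, exists X, g X = e x y) ->
  exists q (e' : I * 'I_q -> I * 'I_q -> A),
    [/\ matrix_units e', forall u v, exists X, g X = e' u v,
        forall x y, e x y = \sum_a e' (x, a) (y, a)
      & q = 1%N -> forall X, exists m, g X = kernel_op e m].
Proof.
move=> he eg; have /choice[E0 E0P] : forall u, exists X, g X = e u.1 u.2 by move=> u.
pose E x y := E0 (x, y); have gE x y : g (E x y) = e x y by exact: E0P.
have EM x y z t : E x y *m E z t = if y == z then E x t else 0.
  by apply: emb_inj; rewrite embM// !gE unitsM//; case: ifP; rewrite ?gE ?emb0.
have ES x y : (E x y)^t* = E y x by apply: emb_inj; rewrite emb_adj// !gE units_star.
have E1 : \sum_x E x x = 1%:M.
  apply: emb_inj; rewrite emb_sum (emb_one hg) -(units_sum he).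
  by apply: eq_bigr => x _; rewrite gE.
have [|q [F [FF Fp]]] := projection_factor (_ : E x0 x0 *m E x0 x0 = _) (ES x0 x0).
  by rewrite EM eqxx.
pose v (u : I * 'I_q) : 'M[C]_(1, n.+1) := row u.2 F *m E x0 u.1.
have rFp a : row a F *m E x0 x0 = row a F.
  by rewrite -row_mul -Fp mulmxA FF mul1mx.
have rFF a b : row a F *m (row b F)^t* = (a == b)%:R%:M.
  apply/matrixP => i j; rewrite !ord1.
  have := congr1 (fun X : 'M[C]_q => X a b) FF; rewrite !mxE /= => <-.
  by apply: eq_bigr => k _; rewrite !mxE.
have vv u w : v u *m (v w)^t* = (u == w)%:R%:M.
  case: u w => [x a] [y b]; rewrite /v adjM ES /= mulmxA -(mulmxA (row a F)) EM.
  rewrite xpair_eqE; case: eqP => _; last by rewrite mulmx0 mul0mx /= raddf0.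
  by rewrite rFp rFF.
have Fsum : \sum_a (row a F)^t* *m row a F = E x0 x0.
  rewrite -Fp; apply/matrixP => i j; rewrite !mxE summxE; apply: eq_bigr => k _.
  by rewrite !mxE big_ord1 !mxE.
pose e'' u w := (v u)^t* *m v w.
have vsum x y : \sum_a e'' (x, a) (y, a) = E x y.
  transitivity (E x x0 *m (\sum_a (row a F)^t* *m row a F) *m E x0 y).
    rewrite mulmx_sumr mulmx_suml; apply: eq_bigr => a _.
    by rewrite /e'' /v adjM ES !mulmxA.
  by rewrite Fsum EM eqxx EM eqxx.
exists q, (fun u w => g (e'' u w)); split.
- split => [x y z t|x y|].
  + rewrite -embM// /e'' -mulmxA (mulmxA (v y)) vv.
    case: eqP => _; first by rewrite mul1mx.
    by rewrite raddf0 mul0mx mulmx0 emb0.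
  + by rewrite -emb_adj// /e'' adjM trmxCK.
  + rewrite -emb_sum -(pair_bigA _ (fun x a => e'' (x, a) (x, a))) /=.
    by under eq_bigr do rewrite vsum; rewrite E1 (emb_one hg).
- by move=> u w; exists (e'' u w).
- by move=> x y; rewrite -emb_sum vsum gE.
- move=> q1; subst q => X.
  (* The compression of [X] to a projection of rank one is scalar. *)
  have cP x y : exists c, E x0 x *m X *m E y x0 = c *: E x0 x0.
    pose Z := E x0 x *m X *m E y x0.
    have -> : E x0 x *m X *m E y x0 = E x0 x0 *m Z *m E x0 x0.
      by rewrite /Z !mulmxA EM eqxx -(mulmxA _ (E y x0)) EM eqxx.
    exists ((F *m Z *m F^t*) 0 0).
    rewrite -Fp; move: Z => Z.
    transitivity (F^t* *m (F *m Z *m F^t*) *m F); first by rewrite !mulmxA.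
    by rewrite [F *m Z *m _]mx11_scalar mul_mx_scalar -scalemxAl !mxE.
  have /choice[c0 c0P] : forall u : I * I, exists c,
    E x0 u.1 *m X *m E u.2 x0 = c *: E x0 x0 by move=> u.
  exists (fun x y => c0 (x, y)).
  rewrite -[X]mulmx1 -[X]mul1mx -E1 mulmx_suml mulmx_suml emb_sum.
  apply: eq_bigr => x _; rewrite mulmx_sumr emb_sum; apply: eq_bigr => y _.
  rewrite -gE -embZ//; congr g.
  have Ez z : E z z = E z x0 *m E x0 z by rewrite EM eqxx.
  rewrite (Ez x) (Ez y).
  rewrite !mulmxA -!(mulmxA (E x x0)) (c0P (x, y)).
  by rewrite -scalemxAl -scalemxAr EM eqxx EM eqxx.
Qed.

End Embedding.

Section Halving.
Variable R : realType.
Local Notation C := R[i].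

Lemma half_powC k : (2^-1 ^+ k : R)%:C = 2^-1 ^+ k.
Proof. by rewrite rmorphXn fmorphV rmorph_nat. Qed.

Lemma half_pow_gt0 k : 0 < (2^-1 ^+ k : C).
Proof. by rewrite exprn_gt0// invr_gt0 ltr0n. Qed.

Lemma half_pow_lt (x : C) : 0 < x -> exists k, 2^-1 ^+ k < x.
Proof.
move=> x0; have xr : x = (complex.Re x)%:C by rewrite RRe_real// gtr0_real.
have {}x0 : 0 < complex.Re x by rewrite -ltcR -xr.
exists (Num.bound (complex.Re x)^-1); rewrite xr -half_powC ltcR exprVn.
have := archi_boundP (ltW (_ : 0 < (complex.Re x)^-1)); rewrite invr_gt0 => /(_ x0) h.
rewrite -[ltRHS]invrK ltf_pV2 ?posrE ?exprn_gt0 ?ltr0n ?invr_gt0//.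
by rewrite (lt_trans h)// -natrX ltr_nat ltn_expl.
Qed.

Lemma norm_le_small (V : normedModType C) (x : V) (c : C) : 0 < c ->
  (forall k, `|x| <= c * 2^-1 ^+ k) -> x = 0.
Proof.
move=> c0 xk; apply/eqP/negPn/negP; rewrite -normr_gt0 => x0.
have [k] := half_pow_lt (divr_gt0 x0 c0); rewrite ltr_pdivlMr// mulrC => /lt_le_trans.
by move=> /(_ _ (xk k)); rewrite ltxx.
Qed.

(** The intervals [[x k - d k, x k + d k]] meet pairwise, so they have a common
    point. *)
Lemma real_limit (x d : nat -> R) : (forall k l, x k - d k <= x l + d l) ->
  exists a, forall k, `|x k - a| <= d k.
Proof.
move=> xd; exists (sup (range (fun k => x k - d k))) => k.
have ub l : ubound (range (fun k => x k - d k)) (x l + d l) by move=> _ [m _ <-].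
have h1 : x k - d k <= sup (range (fun k => x k - d k)).
  by apply: ub_le_sup; [exists (x 0%N + d 0%N) | exists k].
have h2 : sup (range (fun k => x k - d k)) <= x k + d k.
  by apply: ge_sup => //; exists (x 0%N - d 0%N); exists 0%N.
by rewrite ler_norml; apply/andP; split; lra.
Qed.

Lemma norm_ReIm (z : C) : `|z| <= (`|complex.Re z| + `|complex.Im z|)%:C.
Proof.
rewrite {1}[z]complexE (le_trans (ler_normD _ _))// rmorphD lerD//.
  by rewrite normc_def /= expr0n addr0 sqrtr_sqr.
by rewrite normrM !normc_def /= !expr0n /= !addr0 add0r expr1n sqrtr1 mul1r sqrtr_sqr.
Qed.

Lemma normc_ge_Im (z : C) : `|complex.Im z|%:C <= `|z|.
Proof.
rewrite normc_def lecR -[leLHS]sqrtr_sqr ler_wsqrtr// lerDr sqr_ge0.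
by [].
Qed.

Lemma complex_limit (c : nat -> C) :
  (forall k l, `|c k - c l| <= 2^-1 ^+ k + 2^-1 ^+ l) ->
  exists a, forall k, `|c k - a| <= 2 * 2^-1 ^+ k.
Proof.
move=> cc.
have [k l|a aP] := @real_limit (fun k => complex.Re (c k)) (fun k => 2^-1 ^+ k).
  have := le_trans (normc_ge_Re _) (cc k l).
  by rewrite -!half_powC -rmorphD lecR raddfB /= ler_norml => /andP[_]; lra.
(* The real parts have a limit [a]; the imaginary parts are treated alike. *)
have [k l|b bP] := @real_limit (fun k => complex.Im (c k)) (fun k => 2^-1 ^+ k).
  have := le_trans (normc_ge_Im _) (cc k l).
  by rewrite -!half_powC -rmorphD lecR raddfB /= ler_norml => /andP[_]; lra.
exists (a +i* b) => k; apply: (le_trans (norm_ReIm _)).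
rewrite -half_powC mulr_natl -rmorphMn lecR mulr2n lerD//.
  by have := aP k; rewrite raddfB.
by have := bP k; rewrite raddfB.
Qed.
End Halving.

Section Chain.
Variables (R : realType) (A : cstarType R).
Local Notation C := R[i].

Lemma closureP (S : set A) (x : A) :
  closure S x <-> forall eps : C, 0 < eps -> exists2 s, S s & `|x - s| < eps.
Proof.
split=> [Sx eps eps0|h B].
  have [s [Ss xs]] := Sx _ (nbhsx_ballx x _ eps0).
  by exists s => //; move: xs; rewrite -ball_normE.
move=> /nbhs_ballP[eps /= eps0 xB].
have [s Ss xs] := h _ eps0; exists s; split=> //; apply: xB.
by rewrite -ball_normE.
Qed.

(** Replaces the abstract matrix algebras of the direct system by concrete ones,
    included in [A]. *)
Lemma UHF_chain : UHF A ->
  exists (n : nat -> nat) (g : forall k, 'M[C]_((n k).+1) -> A),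
  [/\ forall k, embedding (g k),
      forall k, range (g k) `<=` range (g k.+1)
    & closure (\bigcup_k range (g k)) = setT].
Proof.
move=> [B [phi [psi [full _ _ [psiS psi_phi _ dense]]]]].
have /choice[n /(_ _)/cid-/all_sig[f fP]] := full.
have /(_ _)/cid-/all_sig[h hP] : forall k, exists h, cancel (f k) h /\ cancel h (f k).
  by move=> k; have [[h fh hf] _] := fP k; exists h.
pose g k (X : 'M[C]_((n k).+1)) : A := psi k (h k X).
have rg k : range (g k) = range (psi k).
  apply/seteqP; split=> a [x _ <-]; first by exists (h k x).
  by exists (f k x) => //; rewrite /g; case: (hP k) => -> _.
exists n, g; split.
- move=> k; have [fK hK] := hP k; have fI := can_inj fK.
  split => [X Y|c X|X Y||X]; rewrite /g.
  + by rewrite -rmorphD; congr (psi k _); apply: fI; rewrite rmorphD /= !hK.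
  + by rewrite -linearZ; congr (psi k _); apply: fI; rewrite linearZ /= !hK.
  + by rewrite -rmorphM; congr (psi k _); apply: fI; rewrite rmorphM /= !hK.
  + by rewrite -(rmorph1 (psi k)); congr (psi k _); apply: fI; rewrite hK [RHS]rmorph1.
  + by rewrite -psiS; congr (psi k _); apply: fI; case: (fP k) => _ ->; rewrite /= !hK.
- by move=> k; rewrite !rg => a [x _ <-]; exists (phi k x).
- by rewrite -dense; congr closure; apply: eq_bigcupr => k _; rewrite rg.
Qed.

(** The coefficients of approximants on the line form a Cauchy sequence of
    complex numbers. *)
Lemma line_closed (p w : A) : `|p| = 1 ->
  (forall eps : C, 0 < eps -> exists c : C, `|w - c *: p| < eps) ->
  exists c : C, w = c *: p.
Proof.
move=> p1 wP.
have /choice[c cP] k : exists c : C, `|w - c *: p| < 2^-1 ^+ k.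
  by apply: wP; apply: half_pow_gt0.
have [k l|a aP] := @complex_limit _ c.
  have -> : `|c k - c l| = `|(c k - c l) *: p| by rewrite normrZ p1 mulr1.
  rewrite scalerBl -(subrK w (c k *: p)) -addrA.
  apply: (le_trans (ler_normD _ _)); apply: lerD; last exact: ltW (cP l).
  by rewrite distrC; exact: ltW (cP k).
exists a; apply/eqP; rewrite -subr_eq0; apply/eqP.
apply: (@norm_le_small _ _ _ 3) => // k.
rewrite -(subrK (c k *: p) w) -addrA -scalerBl.
apply: (le_trans (ler_normD _ _)); rewrite normrZ p1 mulr1.
apply: (le_trans (lerD (ltW (cP k)) (aP k))).
by rewrite -[X in X + _]mul1r -mulrDl.
Qed.

Lemma kernel_op_unit (I : finType) (e : I -> I -> A) (m : I -> I -> C) x0 x y :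
  matrix_units e -> e x0 x * kernel_op e m * e y x0 = m x y *: e x0 x0.
Proof.
move=> he; rewrite /kernel_op mulr_sumr mulr_suml (bigD1 x)//= [X in _ + X]big1 ?addr0.
  rewrite mulr_sumr mulr_suml (bigD1 y)//= [X in _ + X]big1 ?addr0.
    by rewrite -scalerAr -scalerAl unitsM// eqxx unitsM// eqxx.
  move=> z /negPf zy; rewrite -scalerAr -scalerAl unitsM// eqxx unitsM// zy.
  by rewrite scaler0.
move=> z /negPf zx; rewrite mulr_sumr mulr_suml big1// => u _.
by rewrite -scalerAr -scalerAl unitsM// eq_sym zx mul0r scaler0.
Qed.

(** The span of a system of units is closed because each coordinate of its
    elements, read on a line as [e x0 x * a * e y x0], passes to the limit. *)
Lemma kernel_op_closed (I : finType) (e : I -> I -> A) (x0 : I) (a : A) :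
  matrix_units e -> closure (range (kernel_op e)) a -> range (kernel_op e) a.
Proof.
move=> he /closureP ca.
have line x y : exists c, e x0 x * a * e y x0 = c *: e x0 x0.
  apply: line_closed; first exact: norm_unit.
  move=> eps eps0; have [_ [m _ <-] am] := ca _ eps0.
  exists (m x y); rewrite -(kernel_op_unit m x0 x y he) -mulrBl -mulrBr.
  apply: le_lt_trans am; apply: norm_mul_le_r; last first.
    by rewrite norm_unit_le1.
  by apply: norm_mul_le_l; rewrite ?norm_unit_le1.
have /choice[m0 m0P] : forall u : I * I, exists c,
    e x0 u.1 * a * e u.2 x0 = c *: e x0 x0.
  by move=> u.
exists (fun x y => m0 (x, y)) => //.
rewrite -[a]mulr1 -[a]mul1r -(units_sum he) mulr_suml mulr_suml.
apply: eq_bigr => x _; rewrite mulr_sumr; apply: eq_bigr => y _.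
have ez z w : e z w = e z x0 * e x0 w by rewrite unitsM// eqxx.
rewrite (ez x x) [in RHS](ez y y) !mulrA -!(mulrA (e x x0)) (m0P (x, y)) /=.
by rewrite -scalerAl -scalerAr unitsM// eqxx unitsM// eqxx.
Qed.

(** If all the later refinements were trivial, all the matrix algebras of the
    chain would lie in the span of [e], which is closed; by density that span
    would be [A], and [A] a full matrix algebra. *)
Lemma nonelementary_refine (n : nat -> nat) (g : forall k, 'M[C]_((n k).+1) -> A)
    (k : nat) (I : finType) (e : I -> I -> A) :
  nonelementary A ->
  (forall k, embedding (g k)) -> (forall k, range (g k) `<=` range (g k.+1)) ->
  closure (\bigcup_k range (g k)) = setT ->
  matrix_units e -> (forall x y, range (g k) (e x y)) ->
  exists k' q (e' : I * 'I_q.+2 -> I * 'I_q.+2 -> A),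
    [/\ matrix_units e', forall u v, range (g k') (e' u v)
      & forall x, e x x = \sum_a e' (x, a) (x, a)].
Proof.
move=> ne hg incl dense he ge; have [x0] := units_inhabited he.
have mono i j : (i <= j)%N -> range (g i) `<=` range (g j).
  move=> /subnK <-; elim: (j - i)%N => // l IH.
  by apply: subset_trans (incl _).
apply: contrapT => none; apply: ne; apply: (emb_surjective_full (hg k)) => a.
have in_span j : (k <= j)%N -> range (g j) `<=` range (kernel_op e).
  move=> kj b [X _ <-].
  have ej x y : exists Y, g j Y = e x y.
    by have [Y _ <-] := mono _ _ kj _ (ge x y); exists Y.
  have [q [e' [he' ge' ee' span]]] := refine_units (hg j) x0 he ej.
  case: q => [|[|q]] in e' he' ge' ee' span.
  - by have /eqP := unit_neq0 he x0; rewrite ee' big_ord0.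
  - by have [m ->] := span erefl X; exists m.
  - exfalso; apply: none; exists j, q, e'; split=> // u v.
    by have [Y <-] := ge' u v; exists Y.
have : range (kernel_op e) a.
  apply: (kernel_op_closed x0 he); have : setT a by []; rewrite -dense.
  apply: closureS => b [j _ bj]; have [kj|/ltnW jk] := leqP k j; first exact: in_span bj.
  by apply: (in_span k) => //; apply: mono bj.
move=> [m _ <-].
have /choice[E0 E0P] : forall u, exists X, g k X = e u.1 u.2.
  by move=> u; have [X _ <-] := ge u.1 u.2; exists X.
exists (\sum_x \sum_y m x y *: E0 (x, y)).
rewrite emb_sum//; apply: eq_bigr => x _; rewrite emb_sum//; apply: eq_bigr => y _.
by rewrite embZ// E0P.
Qed.

End Chain.

(** * Polar coordinates *)

Section Cis.
Variable R : realType.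
Local Notation C := R[i].
Implicit Types a b r : R.

Lemma cos_lip a b : `|cos a - cos b| <= `|a - b|.
Proof.
wlog ab : a b / b <= a.
  by move=> h; case: (leP b a) => [/h//|/ltW/h]; rewrite distrC (distrC b).
have [c _ ->] := @MVT_segment R cos (fun x => - sin x) b a ab
  (fun x _ => is_derive_cos x)
  (continuous_subspaceT (@continuous_cos R)).
by rewrite normrM normrN -[leRHS]mul1r ler_wpM2r// sin_max.
Qed.

Lemma sin_lip a b : `|sin a - sin b| <= `|a - b|.
Proof.
wlog ab : a b / b <= a.
  by move=> h; case: (leP b a) => [/h//|/ltW/h]; rewrite distrC (distrC b).
have [c _ ->] := @MVT_segment R sin cos b a ab (fun x _ => is_derive_sin x)
  (continuous_subspaceT (@continuous_sin R)).
by rewrite normrM -[leRHS]mul1r ler_wpM2r// cos_max.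
Qed.

Definition cis a : C := cos a +i* sin a.

Lemma cisD a b : cis (a + b) = cis a * cis b.
Proof.
rewrite /cis cosD sinD; apply/eqP; rewrite eq_complex /= eqxx/=.
by apply/eqP; ring.
Qed.

Lemma cis0 : cis 0 = 1. Proof. by rewrite /cis cos0 sin0. Qed.

Lemma cisX a n : cis a ^+ n = cis (a *+ n).
Proof. by elim: n => [|n IH]; rewrite ?cis0// exprS IH mulrS cisD. Qed.

Lemma cis_conj a : Num.conj (cis a) * cis a = 1.
Proof.
rewrite mulrC -normCK normc_def /= cos2Dsin2 sqrtr1.
by rewrite expr1n.
Qed.

Lemma norm_cis a : `|cis a| = 1.
Proof. by rewrite normc_def /= cos2Dsin2 sqrtr1. Qed.

Lemma cis_lip a b : `|cis a - cis b| <= (2 * `|a - b|)%:C.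
Proof.
apply: (le_trans (norm_ReIm _)); rewrite lecR !raddfB /= mulr_natl mulr2n.
by rewrite lerD ?cos_lip ?sin_lip.
Qed.

Lemma cispi : cis pi = -1.
Proof. by rewrite /cis cospi sinpi; apply/eqP; rewrite eq_complex /= oppr0 !eqxx. Qed.

Lemma cis_neq1 a : 0 < a < pi *+ 2 -> cis a != 1.
Proof.
move=> /andP[a0 a2]; rewrite eq_complex /= negb_and; apply/orP; left.
have -> : a = (a / 2) *+ 2 by rewrite -mulr_natr divfK.
have : 0 < sin (a / 2).
  by apply: sin_gt0_pi; rewrite divr_gt0//= ltr_pdivrMr// mulr_natr.
rewrite cos_mulr2n cos2sin2 => s0; apply/eqP => h.
have : sin (a / 2) ^+ 2 > 0 by rewrite exprn_gt0.
by lra.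
Qed.

(** The angle is [acos] of the normalized real part, reflected when the imaginary
    part is negative. *)
Lemma polar (z : C) : `|z| <= 1 ->
  exists r a, [/\ 0 <= r <= 1, 0 <= a <= pi *+ 2 & z = r%:C * cis a].
Proof.
move=> z1; have [->|z0] := eqVneq z 0.
  by exists 0, 0; rewrite lexx ler01 mulrn_wge0 ?pi_ge0// mul0r.
pose r := Num.sqrt (complex.Re z ^+ 2 + complex.Im z ^+ 2).
have zr : `|z| = r%:C by rewrite normc_def.
have r0 : 0 < r by rewrite -ltcR -zr normr_gt0.
have r1 : r <= 1 by rewrite -lecR -zr.
have rr : r ^+ 2 = complex.Re z ^+ 2 + complex.Im z ^+ 2.
  by rewrite sqr_sqrtr// addr_ge0 ?sqr_ge0.
pose c := complex.Re z / r; pose s := complex.Im z / r.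
have cs : c ^+ 2 + s ^+ 2 = 1.
  by rewrite !expr_div_n -mulrDl -rr divff// expf_eq0 /= gt_eqF.
have c1 : -1 <= c <= 1.
  by rewrite -ler_norml -(@expr_le1 _ 2)// real_normK ?num_real//; have := sqr_ge0 s; lra.
have main a : cos a = c -> sin a = s -> z = r%:C * cis a.
  move=> ca sa; rewrite /cis ca sa.
  apply/eqP; rewrite eq_complex /= !mul0r subr0 addr0.
  by rewrite /c /s !(mulrC r) !divfK ?(lt0r_neq0 r0)// !eqxx.
have acK : cos (acos c) = c by apply: acosK; rewrite in_itv.
have a0 := acos_ge0 c1; have api := acos_lepi c1.
have p2 : (pi : R) *+ 2 = pi + pi by rewrite mulr2n.
have sE : sin (acos c) = `|s|.
  by rewrite sin_acos// -sqrtr_sqr; congr Num.sqrt; lra.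
have [s0|s0] := leP 0 s.
  exists r, (acos c); split; rewrite ?(ltW r0) ?r1 ?a0//.
    by rewrite p2 (le_trans api)// lerDl pi_ge0.
  by apply: main; rewrite ?sE ?ger0_norm.
exists r, (- acos c + pi *+ 2); split; rewrite ?(ltW r0) ?r1//.
  by apply/andP; split; [have := pi_ge0 R | ]; lra.
apply: main; first by rewrite cosD2pi cosN.
by rewrite sinD2pi sinN sE ltr0_norm// opprK.
Qed.

End Cis.

(** * Polar grids in the disk *)

Section Tent.
Variable R : realType.
Local Notation C := R[i].

(** Folding [[0, 1]] onto itself gives radii that cover the whole segment and
    yet vary slowly along the cycle obtained by gluing its ends. *)
Definition tent (x : R) : R := 1 - `|1 - 2 * x|.

Lemma tent_lip x y : `|tent x - tent y| <= 2 * `|x - y|.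
Proof.
have -> : tent x - tent y = `|1 - 2 * y| - `|1 - 2 * x| by rewrite /tent; ring.
apply: (le_trans (ler_dist_dist _ _)).
have -> : 1 - 2 * y - (1 - 2 * x) = 2 * (x - y) by ring.
by rewrite normrM ger0_norm.
Qed.

Lemma tent_sym x : tent (1 - x) = tent x.
Proof. by rewrite /tent -normrN; congr (1 - `| _ |); ring. Qed.

Lemma tent0 : tent 0 = 0.
Proof. by rewrite /tent mulr0 subr0 normr1 subrr. Qed.

Lemma tent_itv x : 0 <= x <= 1 -> 0 <= tent x <= 1.
Proof.
move=> x01; rewrite /tent gerBl normr_ge0 andbT subr_ge0 ler_norml.
by apply/andP; split; lra.
Qed.

Lemma tent_half x : 0 <= x <= 1 -> tent (x / 2) = x.
Proof. by move=> x01; rewrite /tent mulrCA divff// mulr1 ger0_norm; lra. Qed.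

Definition height L (a : 'I_L.+1) : R := tent (a%:R / L.+1%:R).

Lemma height_itv L (a : 'I_L.+1) : 0 <= height a <= 1.
Proof.
apply: tent_itv; rewrite divr_ge0//= ler_pdivrMr ?ltr0n// mul1r ler_nat.
exact/ltnW.
Qed.

Lemma height0 L : height (0 : 'I_L.+1) = 0.
Proof. by rewrite /height mul0r tent0. Qed.

(** This makes the first reflection commute exactly with the radii; the second
    one moves them by at most one step of the grid. *)
Lemma heightN L (a : 'I_L.+1) : height (- a) = height a.
Proof.
have [->|a0] := eqVneq a 0; first by rewrite oppr0.
have apos : (0 < a)%N by rewrite lt0n; apply: contra_neq a0 => a0; apply: ord_inj.
rewrite /height [nat_of_ord (- a)]/= modn_small; last by rewrite ltn_subrL apos.
rewrite natrB; last exact/ltnW.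
by rewrite mulrBl divff ?pnatr_eq0// tent_sym.
Qed.

Lemma height_reflect L (a : 'I_L.+1) : `|height (Zp1 - a) - height a| <= 2 / L.+1%:R.
Proof.
have n0 : 0 < (L.+1%:R : R) by rewrite ltr0n.
rewrite -heightN opprB; set b := a - Zp1.
have -> : a = b + Zp1 by rewrite subrK.
have [bL|bL] := ltnP b L.
  rewrite /height succ_ord_lt//; apply: (le_trans (tent_lip _ _)).
  rewrite -mulrBl ler_wpM2l// -natr1 opprD addrA subrr add0r mulN1r normrN.
  by rewrite ger0_norm// invr_ge0 ltW.
have {}bL : nat_of_ord b = L by apply/eqP; rewrite eqn_leq bL -ltnS ltn_ord.
rewrite succ_ord_max// height0 -tent0 /height bL -tent_sym.
apply: (le_trans (tent_lip _ _)); rewrite ler_wpM2l// subr0.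
have -> : 1 - L%:R / L.+1%:R = L.+1%:R^-1 :> R.
  rewrite -[X in X - _](divff (lt0r_neq0 n0)) -mulrBl.
  by rewrite -natr1 addrC addKr mul1r.
by rewrite ger0_norm// invr_ge0 ltW.
Qed.

End Tent.

Section Level.
Variables (R : realType).
Local Notation C := R[i].
Local Notation II L M := ('I_L.+1 * 'I_M.+1)%type.

Definition angle n k : R := pi *+ 2 * (k%:R / n.+1%:R).

(** The angular factor is written as a power, the form in which the Fourier
    transform needs it. *)
Definition grid L M (x : II L M) : C :=
  (height R x.1)%:C * cis (angle M 1) ^+ x.2.

(** Both the distance from a grid point to the points refining it and the
    distance from the operator to the nilpotents are bounded by this. *)
Definition mesh L M : R := 2 / L.+1%:R + 4 * pi / M.+1%:R.

Lemma mesh_ge0 L M : 0 <= mesh L M.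
Proof. by rewrite addr_ge0// divr_ge0// mulr_ge0// pi_ge0. Qed.

Lemma gridE L M (x : II L M) : grid x = (height R x.1)%:C * cis (angle M x.2).
Proof.
by rewrite /grid cisX; congr (_ * cis _); rewrite /angle mul1r -mulr_natr; ring.
Qed.

Lemma polar_lip (r s a b : R) : 0 <= r <= 1 ->
  `|r%:C * cis a - s%:C * cis b| <= (`|r - s| + 2 * `|a - b|)%:C.
Proof.
move=> /andP[r0 r1].
have -> : r%:C * cis a - s%:C * cis b = (r - s)%:C * cis b + r%:C * (cis a - cis b).
  by rewrite rmorphB; ring.
apply: (le_trans (ler_normD _ _)); rewrite [leRHS]rmorphD lerD//.
  by rewrite normrM norm_cis mulr1 normc_def /= expr0n addr0 sqrtr_sqr.
rewrite normrM; apply: le_trans (cis_lip a b); rewrite -[leRHS]mul1r ler_wpM2r//.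
by rewrite normc_def /= expr0n addr0 sqrtr_sqr lecR ger0_norm.
Qed.

Lemma norm_grid L M (x : II L M) : `|grid x| <= 1.
Proof.
have /andP[h0 h1] := height_itv R x.1.
rewrite gridE normrM norm_cis mulr1 normc_def /= expr0n addr0 sqrtr_sqr.
by rewrite ger0_norm// lecR.
Qed.

Lemma round_nat (x : R) n : 0 <= x <= 1 -> 
  exists k : 'I_n.+1, `|x - k%:R / n.+1%:R| <= n.+1%:R^-1.
Proof.
move=> /andP[x0 x1]; have n0 : 0 < (n.+1%:R : R) by rewrite ltr0n.
pose k := Num.truncn (x * n.+1%:R).
have /andP[k1 k2] : k%:R <= x * n.+1%:R < k.+1%:R.
  by apply: truncn_itv; rewrite mulr_ge0.
have bnd (j : nat) : `|x * n.+1%:R - j%:R| <= 1 -> `|x - j%:R / n.+1%:R| <= n.+1%:R^-1.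
  move=> h; have -> : x - j%:R / n.+1%:R = (x * n.+1%:R - j%:R) / n.+1%:R.
    by rewrite mulrBl mulfK ?lt0r_neq0.
  by rewrite normrM normfV (gtr0_norm n0) -[leRHS]mul1r ler_wpM2r// invr_ge0 ltW.
have [kn|kn] := ltnP k n.+1.
  exists (Ordinal kn); apply: bnd; rewrite ler_norml -natr1 in k2 *.
  by apply/andP; split; lra.
exists ord_max; apply: bnd => /=.
have xn : x * n.+1%:R <= n.+1%:R by rewrite ler_piMl.
have : n.+1%:R <= k%:R :> R by rewrite ler_nat.
rewrite -!natr1 in xn k1 *; move=> h.
by rewrite ler_norml; apply/andP; split; lra.
Qed.

(** The radius [r] is approximated near its preimage [r / 2] under [tent]. *)
Lemma grid_dense L M (z : C) : `|z| <= 1 ->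
  exists x : II L M, `|grid x - z| <= (mesh L M)%:C.
Proof.
move=> /polar[r [a [/andP[r0 r1] /andP[a0 a2] ->]]].
have p0 : 0 < (pi *+ 2 : R) by rewrite mulrn_wgt0 ?pi_gt0.
have [|i iP] := @round_nat (r / 2) L; first by apply/andP; split; lra.
have [|j jP] := @round_nat (a / (pi *+ 2)) M.
  by rewrite divr_ge0 ?(ltW p0)//= ler_pdivrMr// mul1r.
exists (i, j); rewrite gridE; apply: (le_trans (polar_lip _ _ _ (height_itv R _))).
rewrite lecR lerD//=.
  rewrite -(@tent_half R r) ?r0// distrC; apply: (le_trans (tent_lip _ _)).
  by rewrite ler_wpM2l.
have -> : angle M j - a = - (pi *+ 2 * (a / (pi *+ 2) - j%:R / M.+1%:R)).
  by rewrite mulrBr mulrCA divff ?lt0r_neq0// mulr1 opprB.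
rewrite normrN normrM (ger0_norm (ltW p0)).
rewrite (_ : 4 * pi / _ = 2 * (pi *+ 2 * M.+1%:R^-1)).
  by rewrite ler_wpM2l// ler_wpM2l// ltW.
by rewrite -mulr_natr; ring.
Qed.

Lemma floor_close (y q n n' : nat) : (0 < q)%N -> n'.+1 = (n.+1 * q)%N ->
  `|((y %/ q)%N%:R / n.+1%:R : R) - y%:R / n'.+1%:R| <= n.+1%:R^-1.
Proof.
move=> q0 nq; have n0 : 0 < (n.+1%:R : R) by rewrite ltr0n.
have q0' : 0 < (q%:R : R) by rewrite ltr0n.
have -> : ((y %/ q)%N%:R / n.+1%:R : R) - y%:R / n'.+1%:R =
    - ((y %% q)%N%:R / q%:R / n.+1%:R).
  rewrite {2}(divn_eq y q) nq natrD !natrM; field.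
  by rewrite !lt0r_neq0.
rewrite normrN ger0_norm ?divr_ge0// ler_pdivrMr// mulVf ?lt0r_neq0//.
by rewrite ler_pdivrMr// mul1r ler_nat ltnW// ltn_pmod.
Qed.

Lemma grid_refine L M L' M' q q' (x : II L M) (y : II L' M') :
  (0 < q)%N -> (0 < q')%N -> L'.+1 = (L.+1 * q)%N -> M'.+1 = (M.+1 * q')%N ->
  nat_of_ord x.1 = (y.1 %/ q)%N -> nat_of_ord x.2 = (y.2 %/ q')%N ->
  `|grid x - grid y| <= (mesh L M)%:C.
Proof.
move=> q0 q0' Lq Mq x1 x2; rewrite !gridE.
have p0 : 0 < (pi *+ 2 : R) by rewrite mulrn_wgt0 ?pi_gt0.
apply: (le_trans (polar_lip _ _ _ (height_itv R _))); rewrite lecR lerD//.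
  apply: (le_trans (tent_lip _ _)); rewrite ler_wpM2l// x1.
  exact: floor_close.
rewrite /angle -mulrBr normrM (ger0_norm (ltW p0)) x2.
rewrite (_ : 4 * pi / _ = 2 * (pi *+ 2 * M.+1%:R^-1)).
  by rewrite ler_wpM2l// ler_wpM2l// ?floor_close// ltW.
by rewrite -mulr_natr; ring.
Qed.

(** [zeta] is a square root of the primitive root of unity [om] defining the
    grid: it goes half round the circle while the column index goes round its
    cycle. *)
Lemma grid_near_nilpotent (A : cstarType R) L M (e : II L M -> II L M -> A) :
  matrix_units e ->
  exists2 Q, nilpotents A Q & `|Q - diagonal e (@grid L M)| <= (mesh L M)%:C.
Proof.
move=> he; pose om : C := cis (angle M 1).
have n0 : 0 < (M.+1%:R : R) by rewrite ltr0n.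
have p0 : 0 < (pi : R) by exact: pi_gt0.
have angleM : angle M 1 *+ M.+1 = pi *+ 2.
  by rewrite /angle -[LHS]mulr_natr mul1r divfK // lt0r_neq0.
have omM : om ^+ M.+1 = 1.
  by rewrite cisX angleM /cis cos2pi sin2pi.
have om1 d : (0 < d < M.+1)%N -> om ^+ d != 1.
  move=> /andP[d0 dM]; rewrite cisX cis_neq1//.
  have a0 : 0 < angle M 1 by rewrite mulr_gt0 ?divr_gt0// mulrn_wgt0.
  apply/andP; split; first by rewrite pmulrn_lgt0.
  by rewrite -angleM -subr_gt0 -mulrnBr 1?ltnW// pmulrn_lgt0 ?subn_gt0.
have [Phi [Phi1 Phi2] PhiE] :=
  fourier_unitary he (fun a => (height R a)%:C) omM om1 (cis_conj _).
pose zeta : C := cis (pi / M.+1%:R).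
have zetaM : zeta ^+ M.+1 = -1.
  by rewrite cisX -[X in cis X]mulr_natr divfK ?cispi// lt0r_neq0.
have n0L : 0 < (L.+1%:R : R) by rewrite ltr0n.
have normR (u : R) : `|u%:C| = `|u|%:C :> C.
  by rewrite normc_def /= expr0n addr0 sqrtr_sqr.
have [Q0 [n Q0n] Q0P] : exists2 Q, nilpotents A Q &
    `|Q - monomial e (fun x => (x.1, x.2 + Zp1)) (fun x => (height R x.1)%:C)|
      <= (2 / L.+1%:R)%:C + 2 * `|1 - zeta|.
  apply: (@weighted_cycles_near_nilpotent R A L M e he (fun a => (height R a)%:C)) => //.
  - by move=> a; have /andP[h0 h1] := height_itv R a; rewrite normR ger0_norm// lecR.
  - by move=> a; rewrite heightN.
  - by rewrite height0.
  - by rewrite ler0c divr_ge0// ltW.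
  - by move=> a; rewrite -rmorphB normR lecR height_reflect.
  - exact: cis_conj.
exists (Phi * Q0 * star Phi).
  exists n; have -> : (Phi * Q0 * star Phi) ^+ n = Phi * Q0 ^+ n * star Phi.
    elim: (n) => [|m IH].
      by rewrite !expr0 mulr1; move: Phi2; rewrite /isometry starK.
    by rewrite !exprS IH !mulrA -(mulrA (Phi * Q0)) Phi1 mulr1.
  by rewrite Q0n mulr0 mul0r.
have Phi3 : Phi * star Phi = 1 by move: Phi2; rewrite /isometry starK.
have -> : diagonal e (@grid L M) = Phi * monomial e (fun x => (x.1, x.2 + Zp1))
    (fun x => (height R x.1)%:C) * star Phi.
  by rewrite -PhiE -mulrA Phi3 mulr1.
rewrite -mulrBl -mulrBr; apply: norm_mul_le_r; last first.
  by rewrite norm_star norm_isometry.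
apply: norm_mul_le_l; first by rewrite norm_isometry.
apply: (le_trans Q0P); rewrite [leRHS]rmorphD lerD// mulr_natl.
have -> : 4 * pi / M.+1%:R = (2 * (pi / M.+1%:R)) *+ 2 :> R.
  by rewrite -mulr_natr; ring.
rewrite rmorphMn lerMn2r/= -cis0; apply: (le_trans (cis_lip _ _)).
by rewrite sub0r normrN ger0_norm// divr_ge0// ltW.
Qed.

End Level.

(** * Geometrically convergent sequences of operators *)

Section Limits.
Variables (R : realType) (A : cstarType R).
Local Notation C := R[i].
Implicit Types (x y : nat -> A) (c : C).

(** The tail of the geometric series accounts for [2 * c]; a further [c] absorbs
    the distance from the limit to a remote term. *)
Lemma geometric_limit x c : 0 < c ->
  (forall k, `|x k - x k.+1| <= c * 2^-1 ^+ k) ->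
  exists a, forall k, `|x k - a| <= 3 * c * 2^-1 ^+ k.
Proof.
move=> c0 xc.
have tail k m : `|x k - x (k + m)%N| <= 2 * c * 2^-1 ^+ k.
  suff : `|x k - x (k + m)%N| <= 2 * c * (2^-1 ^+ k - 2^-1 ^+ (k + m)).
    move=> /le_trans; apply; rewrite ler_wpM2l ?mulr_ge0 ?(ltW c0)//.
    by rewrite lerBlDr lerDl ltW// half_pow_gt0.
  elim: m => [|m IH]; first by rewrite addn0 !subrr normr0 mulr0.
  rewrite -(subrK (x (k + m)%N) (x k)) -addrA; apply: (le_trans (ler_normD _ _)).
  rewrite addnS; apply: (le_trans (lerD IH (xc _))).
  rewrite exprS le_eqVlt; apply/orP; left; apply/eqP; by field.
have /cauchy_cvgP/cvg_ex[a xa] : cauchy (x @ \oo).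
  apply: cauchy_exP => eps eps0.
  have [j hj] := half_pow_lt (divr_gt0 eps0 (mulr_gt0 (ltr0n C 2) c0)).
  exists (x j); exists j => // n /= /subnKC <-.
  rewrite -ball_normE /=; apply: le_lt_trans (tail _ _) _.
  by move: hj; rewrite ltr_pdivlMr ?mulr_gt0// mulrC.
exists a => k.
have ck : 0 < c * 2^-1 ^+ k by rewrite mulr_gt0// half_pow_gt0.
have [n /= kn an] : exists2 n, (k <= n)%N & `|a - x n| < c * 2^-1 ^+ k.
  have /cvgrPdist_lt/(_ _ ck)[n _ nP] := xa.
  by exists (maxn k n); rewrite ?leq_maxl//; apply: nP => /=; rewrite leq_maxr.
rewrite -(subrK (x n) (x k)) -addrA; apply: (le_trans (ler_normD _ _)).
rewrite (_ : 3 * c * _ = 2 * c * 2^-1 ^+ k + c * 2^-1 ^+ k); last by ring.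
by have := tail k (n - k)%N; rewrite subnKC// => tkn; rewrite lerD// distrC ltW.
Qed.

Lemma limit_normal x a c : 0 < c -> (forall k, `|x k - a| <= c * 2^-1 ^+ k) ->
  (forall k, `|x k| <= 1) -> (forall k, normal_operator (x k)) -> normal_operator a.
Proof.
move=> c0 xa x1 xn; apply/eqP; rewrite -subr_eq0; apply/eqP.
apply: (@norm_le_small _ _ _ (2 * (`|a| + 1) * c)) => [|k].
  by rewrite !mulr_gt0// ltr_wpDl.
have sxa : `|star (x k) - star a| = `|x k - a| by rewrite -starB norm_star.
have -> : star a * a - a * star a =
    (star (x k) * (a - x k) + (star a - star (x k)) * a) +
    (x k * (star (x k) - star a) + (x k - a) * star a).
  rewrite !mulrBr !mulrBl (xn k).
  have tele (u v w : A) : u - v + (w - u) = w - v by rewrite addrC addrA subrK.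
  have tele' (u v w : A) : u - v + (v - w) = u - w by rewrite addrA subrK.
  by rewrite tele !tele'.
have h1 (b d : A) : `|b| <= 1 -> `|d| = `|x k - a| -> `|b * d| <= c * 2^-1 ^+ k.
  by move=> b1 dE; apply: norm_mul_le_l; rewrite ?dE.
have h2 (b d : A) : `|b| = `|x k - a| -> `|d| = `|a| -> `|b * d| <= `|a| * (c * 2^-1 ^+ k).
  move=> bE dE; apply: (le_trans (norm_mul_le _ _)); rewrite bE dE mulrC.
  by rewrite ler_wpM2l.
apply: (le_trans (ler_normD _ _)).
rewrite (_ : 2 * (`|a| + 1) * c * 2^-1 ^+ k =
  (c * 2^-1 ^+ k + `|a| * (c * 2^-1 ^+ k)) + (c * 2^-1 ^+ k + `|a| * (c * 2^-1 ^+ k))).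
  apply: lerD; apply: (le_trans (ler_normD _ _)); apply: lerD.
  - by apply: h1; rewrite ?norm_star// distrC.
  - by apply: h2; rewrite // distrC.
  - exact: h1.
  - by apply: h2; rewrite ?norm_star.
by ring.
Qed.

(** The inverses form a Cauchy sequence too, by the resolvent identity
    [y k - y k.+1 = y k * (x k.+1 - x k) * y k.+1]. *)
Lemma limit_invertible x y a c B : 0 < c -> 0 < B ->
  (forall k, `|x k - a| <= c * 2^-1 ^+ k) ->
  (forall k, y k * x k = 1) -> (forall k, x k * y k = 1) ->
  (forall k, `|y k| <= B) -> invertible a.
Proof.
move=> c0 B0 xa yx xy yB.
have yy k : `|y k - y k.+1| <= (B * (2 * c) * B) * 2^-1 ^+ k.
  have -> : y k - y k.+1 = y k * (x k.+1 - x k) * y k.+1.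
    by rewrite mulrBr mulrBl -mulrA xy mulr1 yx mul1r.
  rewrite (_ : _ * 2^-1 ^+ k = B * (2 * c * 2^-1 ^+ k) * B); last by ring.
  apply: (le_trans (norm_mul_le _ _)); apply: ler_pM => //.
  apply: (le_trans (norm_mul_le _ _)); apply: ler_pM => //.
  rewrite (_ : 2 * c * 2^-1 ^+ k = c * 2^-1 ^+ k + c * 2^-1 ^+ k); last by ring.
  rewrite -(subrK a (x k.+1)) -addrA; apply: (le_trans (ler_normD _ _)).
  rewrite lerD// 1?[`|a - _|]distrC//.
  apply: (le_trans (xa _)); rewrite ler_wpM2l ?(ltW c0)// exprS.
  by rewrite ler_piMl ?(ltW (half_pow_gt0 _ _))// invf_le1 ?ler1n.
have [|b yb] := geometric_limit _ yy; first by rewrite !mulr_gt0.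
set d := 3 * _ in yb.
have d0 : 0 < d by rewrite !mulr_gt0.
have small : 0 < d * `|a| + B * c.
  by rewrite ltr_wpDl ?mulr_ge0 ?mulr_gt0// ltW.
exists b; split; apply/eqP; rewrite -subr_eq0; apply/eqP;
  apply: (@norm_le_small _ _ _ _ small) => k.
  rewrite -(yx k).
  have -> : b * a - y k * x k = (b - y k) * a + y k * (a - x k).
    by rewrite mulrBl mulrBr addrA subrK.
  apply: (le_trans (ler_normD _ _)); rewrite [leRHS]mulrDl lerD//.
    apply: (le_trans (norm_mul_le _ _)); rewrite mulrAC ler_wpM2r// distrC.
    exact: yb.
  apply: (le_trans (norm_mul_le _ _)); rewrite -mulrA ler_pM// distrC; exact: xa.
rewrite -(xy k).
have -> : a * b - x k * y k = a * (b - y k) + (a - x k) * y k.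
  by rewrite mulrBl mulrBr addrA subrK.
apply: (le_trans (ler_normD _ _)); rewrite [leRHS]mulrDl lerD//.
  apply: (le_trans (norm_mul_le _ _)); rewrite mulrAC mulrC ler_wpM2r// distrC.
  exact: yb.
apply: (le_trans (norm_mul_le _ _)); rewrite mulrC -mulrA ler_pM// distrC; exact: xa.
Qed.

(** An inverse of [a] would bound [`|p k|] by a multiple of [`|a * p k|], which
    tends to 0. *)
Lemma limit_not_invertible x (p : nat -> A) a c : 0 < c ->
  (forall k, `|x k - a| <= c * 2^-1 ^+ k) -> (forall k, `|p k| = 1) ->
  (forall k, `|x k * p k| <= c * 2^-1 ^+ k) -> ~ invertible a.
Proof.
move=> c0 xa p1 xp [b [ba _]]; have /eqP := oner_neq0 A; apply.
apply: (@norm_le_small _ _ _ ((`|b| + 1) * (2 * c))) => [|k].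
  by rewrite !mulr_gt0// ltr_wpDl.
have -> : `|1 : A| = `|b * (a * p k)| by rewrite mulrA ba mul1r norm_one p1.
apply: (le_trans (norm_mul_le _ _)); rewrite -mulrA ler_pM//; first by rewrite lerDl.
rewrite -(subrK (x k) a) mulrDl; apply: (le_trans (ler_normD _ _)).
rewrite (_ : 2 * c * _ = c * 2^-1 ^+ k + c * 2^-1 ^+ k); last by ring.
rewrite lerD//; apply: norm_mul_le_r; first by rewrite distrC.
by rewrite p1.
Qed.
End Limits.

(** * Nested levels and their limit *)

Section Reindex.
Variables (R : realType) (A : cstarType R).
Local Notation C := R[i].

Lemma reindex_units (I J : finType) (e : I -> I -> A) (h : J -> I) (h' : I -> J) :
  cancel h h' -> cancel h' h -> matrix_units e ->
  matrix_units (fun x y => e (h x) (h y)).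
Proof.
move=> hK h'K he; split=> [x y z t|x y|].
- by rewrite unitsM// (can_eq hK).
- by rewrite units_star.
- rewrite -(units_sum he) [RHS](reindex h)//.
  by exists h' => x _; rewrite ?hK ?h'K.
Qed.

Lemma diagonal_refine (I J : finType) (e : I -> I -> A) (e' : J -> J -> A)
    (p : J -> I) (w : I -> C) :
  (forall x, e x x = \sum_(y | p y == x) e' y y) ->
  diagonal e w = diagonal e' (w \o p).
Proof.
move=> ee'; rewrite /diagonal /monomial [RHS](partition_big p predT)//=.
apply: eq_bigr => x _; rewrite ee' scaler_sumr.
by apply: eq_bigr => y /eqP ->.
Qed.

Lemma trivial_units : matrix_units (fun _ _ : 'I_1 * 'I_1 => 1 : A).
Proof.
split=> [[x x'] [y y'] [z z'] t|x y|].
- by rewrite !ord1 eqxx mulr1.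
- exact: star1.
- by rewrite sumr_const card_prod !card_ord mul1n.
Qed.

(** The digits produced by two successive refinements are appended to the row and
    to the column index respectively. *)
Lemma grid_units (L M q q' : nat)
    (e : ('I_L.+1 * 'I_M.+1) * 'I_q.+1 * 'I_q'.+1 ->
         ('I_L.+1 * 'I_M.+1) * 'I_q.+1 * 'I_q'.+1 -> A) (P : A -> Prop) :
  matrix_units e -> (forall u v, P (e u v)) ->
  exists L' M' (e' : 'I_L'.+1 * 'I_M'.+1 -> 'I_L'.+1 * 'I_M'.+1 -> A)
    (p : 'I_L'.+1 * 'I_M'.+1 -> 'I_L.+1 * 'I_M.+1),
  [/\ L'.+1 = (L.+1 * q.+1)%N /\ M'.+1 = (M.+1 * q'.+1)%N,
      matrix_units e' /\ forall u v, P (e' u v),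
      forall y, nat_of_ord (p y).1 = (y.1 %/ q.+1)%N /\
                nat_of_ord (p y).2 = (y.2 %/ q'.+1)%N
    & forall x, \sum_a \sum_b e (x, a, b) (x, a, b) = \sum_(y | p y == x) e' y y].
Proof.
move=> he Pe.
have [L' LE] : exists L', L'.+1 = (L.+1 * q.+1)%N.
  by exists (L.+1 * q.+1).-1; rewrite prednK.
have [M' ME] : exists M', M'.+1 = (M.+1 * q'.+1)%N.
  by exists (M.+1 * q'.+1).-1; rewrite prednK.
have lt1 (y : 'I_L'.+1) : (y %/ q.+1 < L.+1)%N by rewrite ltn_divLR// -LE.
have lt2 (y : 'I_M'.+1) : (y %/ q'.+1 < M.+1)%N by rewrite ltn_divLR// -ME.
have lt3 (a : 'I_L.+1) (b : 'I_q.+1) : (a * q.+1 + b < L'.+1)%N.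
  by rewrite LE -ltn_divLR// divnMDl// divn_small// addn0.
have lt4 (a : 'I_M.+1) (b : 'I_q'.+1) : (a * q'.+1 + b < M'.+1)%N.
  by rewrite ME -ltn_divLR// divnMDl// divn_small// addn0.
pose p (y : 'I_L'.+1 * 'I_M'.+1) : 'I_L.+1 * 'I_M.+1 :=
  (Ordinal (lt1 y.1), Ordinal (lt2 y.2)).
pose h y : 'I_L.+1 * 'I_M.+1 * 'I_q.+1 * 'I_q'.+1 :=
  (p y, inord (y.1 %% q.+1), inord (y.2 %% q'.+1)).
pose h' (u : 'I_L.+1 * 'I_M.+1 * 'I_q.+1 * 'I_q'.+1) : 'I_L'.+1 * 'I_M'.+1 :=
  (Ordinal (lt3 u.1.1.1 u.1.2), Ordinal (lt4 u.1.1.2 u.2)).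
have hK : cancel h h'.
  move=> [a b]; rewrite /h /h'; congr (_, _); apply: ord_inj => /=;
  by rewrite inordK ?ltn_pmod// -divn_eq.
have h'K : cancel h' h.
  move=> [[[a b] c] d]; rewrite /h /h' /p /=; congr (_, _, _, _); apply: ord_inj => /=.
  - by rewrite divnMDl// divn_small// addn0.
  - by rewrite divnMDl// divn_small// addn0.
  - by rewrite modnMDl modn_small// inordK.
  - by rewrite modnMDl modn_small// inordK.
exists L', M', (fun x y => e (h x) (h y)), p; split=> //.
  by split; [exact: reindex_units hK h'K he | move=> u v; apply: Pe].
move=> x; rewrite [RHS](reindex h')/=; last by exists h => u _; rewrite ?hK ?h'K.
under [RHS]eq_bigl => u.
  rewrite (_ : p (h' u) = u.1.1); last by rewrite -[in RHS](h'K u).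
  over.
rewrite [RHS]big_mkcond -(pair_bigA _ (fun v b => if v.1 == x then
  e (h (h' (v, b))) (h (h' (v, b))) else 0)) /=.
rewrite -(pair_bigA _ (fun i a => \sum_b if i == x then
  e (h (h' (i, a, b))) (h (h' (i, a, b))) else 0)) /=.
rewrite (bigD1 x)//= [X in _ + X]big1 ?addr0; last first.
  by move=> i /negPf ix; rewrite big1// => a _; rewrite ix big1.
by apply: eq_bigr => a _; apply: eq_bigr => b _; rewrite eqxx h'K.
Qed.
End Reindex.

Section Levels.
Variables (R : realType) (A : cstarType R).
Local Notation C := R[i].
Variables (n : nat -> nat) (g : forall k, 'M[C]_((n k).+1) -> A).
Hypothesis (ne : nonelementary A) (hg : forall k, embedding (@g k)).
Hypothesis incl : forall k, range (@g k) `<=` range (@g k.+1).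
Hypothesis dense : closure (\bigcup_k range (@g k)) = setT.

Record level := Level {
  rows : nat;
  cols : nat;
  lunit : 'I_rows.+1 * 'I_cols.+1 -> 'I_rows.+1 * 'I_cols.+1 -> A;
  lunitP : matrix_units lunit;
  stage : nat;
  lunit_stage : forall u v, range (@g stage) (lunit u v) }.

Definition level_op (l : level) : A := diagonal (@lunit l) (@grid R (rows l) (cols l)).

(** In the finer units both operators are diagonal, so their distance is that of
    the eigenvalues. *)
Lemma level_refine (l : level) : exists l' : level,
  [/\ (2 * (rows l).+1 <= (rows l').+1)%N, (2 * (cols l).+1 <= (cols l').+1)%N
    & `|level_op l - level_op l'| <= (mesh R (rows l) (cols l))%:C].
Proof.
case: l => L M e he k ek; rewrite /level_op /=.
have [k1 [q [e1 [he1 ek1 ee1]]]] := nonelementary_refine ne hg incl dense he ek.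
have [k2 [q' [e2 [he2 ek2 ee2]]]] := nonelementary_refine ne hg incl dense he1 ek1.
have [L' [M' [e' [p [[LE ME] [he' ek'] pE ee']]]]] := grid_units he2 ek2.
exists (@Level L' M' e' he' k2 ek'); split=> /=.
- by rewrite LE mulnC leq_mul.
- by rewrite ME mulnC leq_mul.
rewrite (diagonal_refine (e' := e') (p := p)); last first.
  by move=> x; rewrite -ee' ee1; apply: eq_bigr => a _; rewrite ee2.
rewrite monomialB; apply: norm_diagonal => // [|y].
  by rewrite ler0c mesh_ge0.
have [p1 p2] := pE y.
exact: (grid_refine _ (ltn0Sn _) (ltn0Sn _) LE ME p1 p2).
Qed.

Lemma level_sequence : exists l : nat -> level, forall k,
  [/\ (2 ^ k <= (rows (l k)).+1)%N, (2 ^ k <= (cols (l k)).+1)%N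
    & `|level_op (l k) - level_op (l k.+1)| <= (mesh R (rows (l k)) (cols (l k)))%:C].
Proof.
have ek u v : range (@g 0) ((fun _ _ : 'I_1 * 'I_1 => 1 : A) u v).
  by exists 1%:M => //; rewrite emb_one.
have step l := cid (level_refine l).
have [l [_ lP]] := dependent_choice step (Level (trivial_units A) ek).
exists l => k.
suff [] : (2 ^ k <= (rows (l k)).+1)%N /\ (2 ^ k <= (cols (l k)).+1)%N.
  by split=> //; have [] := lP k.
elim: k => [|k [IH1 IH2]]; first by rewrite expn0.
have [r c _] := lP k; rewrite expnS.
by split; [apply: leq_trans r | apply: leq_trans c]; rewrite leq_mul2l.
Qed.

Lemma mesh_small L M k : (2 ^ k <= L.+1)%N -> (2 ^ k <= M.+1)%N ->
  (mesh R L M)%:C <= (2 + 4 * pi)%:C * 2^-1 ^+ k.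
Proof.
move=> kL kM; rewrite -half_powC -rmorphM lecR mulrDl.
have h j : (2 ^ k <= j.+1)%N -> j.+1%:R^-1 <= 2^-1 ^+ k :> R.
  move=> kj; rewrite exprVn lef_pV2 ?posrE ?exprn_gt0 ?ltr0n//.
  by rewrite -natrX ler_nat.
by rewrite lerD// ler_wpM2l ?h// mulr_ge0 ?pi_ge0.
Qed.

End Levels.

Theorem theorem3p9 (R : realType) (A : cstarType R)
    (hUHF : UHF A) (hne : nonelementary A) :
  exists N : A,
    [/\ normal_operator N,
        closure (nilpotents A) N
      & spectrum N = [set z : R[i] | `|z| <= 1]].
Proof.
have [n [g [hg incl dense]]] := UHF_chain hUHF.
have [l lP] := level_sequence hne hg incl dense.
pose x k := level_op (l k); pose c : R[i] := (2 + 4 * pi)%:C.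
have c0 : 0 < c by rewrite /c ltcR addr_gt0// mulr_gt0// pi_gt0.
have meshc k : (mesh R (rows (l k)) (cols (l k)))%:C <= c * 2^-1 ^+ k.
  by have [h1 h2 _] := lP k; apply: mesh_small.
have [|N xN] := @geometric_limit _ _ x c c0.
  by move=> k; apply: le_trans (meshc k); have [] := lP k.
have c3 : 0 < 3 * c by rewrite mulr_gt0.
have x1 k : `|x k| <= 1.
  by apply: norm_diagonal => //; [exact: lunitP | move=> u; apply: norm_grid].
exists N; split.
- apply: (limit_normal c3 xN x1) => k; have lk := lunitP (l k).
  rewrite /normal_operator diagonal_star// !monomialM//.
  by apply: eq_monomial => // u; rewrite mulrC.
- apply/closureP => eps eps0.
  have [|k hk] := @half_pow_lt R (eps / (4 * c)).
    by rewrite divr_gt0// mulr_gt0.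
  have [Q nilQ Qx] := grid_near_nilpotent (lunitP (l k)).
  exists Q => //; rewrite ltr_pdivlMr ?mulr_gt0// mulrC in hk.
  apply: le_lt_trans hk; rewrite distrC -(subrK (x k) Q) -addrA.
  apply: (le_trans (ler_normD _ _)).
  rewrite (_ : 4 * c * _ = c * 2^-1 ^+ k + 3 * c * 2^-1 ^+ k); last by ring.
  by apply: lerD => //; apply: le_trans (meshc k).
have xz z k : x k - z%:A = diagonal (@lunit _ _ _ _ (l k))
    (fun u => grid R u - z).
  rewrite -(diagonal1 (lunitP (l k))) monomialZ monomialB.
  by apply: eq_monomial => // u; rewrite mulr1.
have xNz z k : `|(x k - z%:A) - (N - z%:A)| <= 3 * c * 2^-1 ^+ k.
  by rewrite opprB addrA subrK.
apply/seteqP; split=> z /=.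
  move=> sz; apply/negPn/negP; rewrite -real_ltNge ?normr_real ?real1// => z1.
  apply: sz.
  have zg k (u : 'I_(rows (l k)).+1 * 'I_(cols (l k)).+1) : `|z| - 1 <= `|grid R u - z|.
    rewrite distrC; apply: le_trans (lerB_dist _ _).
    by rewrite lerD2l lerN2 norm_grid.
  have z10 : 0 < `|z| - 1 by rewrite subr_gt0.
  have gz0 k (u : 'I_(rows (l k)).+1 * 'I_(cols (l k)).+1) : grid R u - z != 0.
    by rewrite -normr_gt0 (lt_le_trans z10).
  apply: (@limit_invertible _ _ (fun k => x k - z%:A) (fun k => diagonal
    (@lunit _ _ _ _ (l k)) (fun u => (grid R u - z)^-1)) _ _ (`|z| - 1)^-1 c3) => //.
  - by rewrite invr_gt0.
  - move=> k; rewrite xz (monomialM (lunitP (l k))) -(diagonal1 (lunitP (l k))).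
    by apply: eq_monomial => // u /=; rewrite mulVf.
  - move=> k; rewrite xz (monomialM (lunitP (l k))) -(diagonal1 (lunitP (l k))).
    by apply: eq_monomial => // u /=; rewrite mulfV.
  - move=> k; apply: norm_diagonal; rewrite ?invr_ge0 ?(ltW z10)//; first exact: lunitP.
    by move=> u; rewrite normfV lef_pV2 ?posrE ?normr_gt0.
move=> z1.
have near_z k : {u : 'I_(rows (l k)).+1 * 'I_(cols (l k)).+1 |
    `|grid R u - z| <= (mesh R (rows (l k)) (cols (l k)))%:C}.
  by apply: cid; apply: grid_dense.
have [u uP] := all_sig near_z.
apply: (@limit_not_invertible _ _ (fun k => x k - z%:A)
  (fun k => lunit (u k) (u k)) _ _ c3) => // k.
  by rewrite norm_unit//; exact: lunitP.
rewrite xz -monomial_delta monomialM; last exact: lunitP.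
apply: norm_diagonal; first exact: lunitP.
  by rewrite mulr_ge0 ?(ltW c3)// ltW// half_pow_gt0.
move=> v /=; have [->|_] := eqVneq v (u k); last first.
  by rewrite mulr0 normr0 mulr_ge0 ?(ltW c3)// ltW// half_pow_gt0.
rewrite mulr1 (le_trans (uP k))// (le_trans (meshc k))//.
rewrite -mulrA -[leLHS]mul1r ler_wpM2r//; last by rewrite ler1n.
by rewrite mulr_ge0 ?(ltW c0)// ltW// half_pow_gt0.
Qed.
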